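(* Let $N\ge 2$ be an integer, $h=1/N$, $T>0$, and let $k>0$ be a time step, $r=k/h$. Let $f,g$ be functions with values in $\mathbb{C}^m$, let $A,A_1,A_2,B_1,B_2,E\in\mathbb{C}^{m\times m}$ with $E$ singular, and let $\gamma\in\mathbb{C}$ be such that $\gamma E+A$ is invertible. Put $\hat E=(\gamma E+A)^{-1}E$, $\hat A=(\gamma E+A)^{-1}A$, let $\hat E^{D}$ be the Drazin inverse of $\hat E$, and suppose that $z\neq 0$ for some $z\in\sigma(\hat E^{D}\hat A)$. Let $(\alpha,\beta)\in\mathbb{R}^2$ be the parameters of the discrete Sturm–Liouville problem (SL) described in the context, with eigenvalues $\lambda_l$ and eigenfunctions $v_l$, $0<l<N$, and suppose that the matrix $$\mathcal{G}(\alpha,\beta)=\begin{pmatrix}\alpha A_1-A_2\\ \beta B_1-B_2\end{pmatrix}\in\mathbb{C}^{2m\times m}$$ satisfies $\operatorname{rank}\mathcal{G}(\alpha,\beta)<m$. Let $F(i),G(i)\in\mathbb{C}^m$ be bounded and such that $$\hat E\hat E^{D}F(i)=F(i),\qquad \hat E\hat E^{D}G(i)=G(i),$$ $$\{F(i),G(i):0<i<N\}\subset\ker\mathcal{G}(\alpha,\beta),\qquad \mathcal{G}(\alpha,\beta)\,\hat E^{D}\hat A\,\bigl(I-\mathcal{G}(\alpha,\beta)^{+}\mathcal{G}(\alpha,\beta)\bigr)=0 .$$ For each $l$ with $0<l<N$ put $\rho=-r^2\lambda_l$ and suppose that $\rho d\left(1+\tfrac{\rho}{4}d\right)\neq 0$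 for all $d\in\sigma(\hat E^{D}\hat A)\setminus\{0\}$ and that $\rho\le r^2\max\{|\lambda_s|:1\le s\le N-1\}$. Then a stable solution of the discrete problem $$r^2A\bigl(U(i+1,j)+U(i-1,j)\bigr)+2(E-r^2A)U(i,j)-E\bigl(U(i,j+1)+U(i,j-1)\bigr)=0,\quad 0<i<N,\ j>0,$$ $$A_1U(0,j)+NA_2\bigl(U(1,j)-U(0,j)\bigr)=0,\quad j>0,$$ $$B_1U(N,j)+NB_2\bigl(U(N,j)-U(N-1,j)\bigr)=0,\quad j>0,$$ $$U(i,0)=F(i),\qquad \frac{U(i,1)-U(i,0)}{k}=G(i),\quad 0\le i\le N,$$ is given by $$U(i,j)=\sum_{l=1}^{N-1}\left(\hat Z_{0}^{\,j}\hat E\hat E^{D}P_l+\hat Z_{1}^{\,j}\hat E\hat E^{D}Q_l\right)v_l(i),$$ where $\hat Z_0=\hat Z_0(l)$, $\hat Z_1=\hat Z_1(l)$ are the matrices defined in the context with $\rho=-r^2\lambda_l$, and $$P_l=\left[(\hat Z_1-\hat Z_0)\hat E\hat E^{D}\right]^{G}\frac{\sum_{i=1}^{N-1}v_l(i)\left[kG(i)+(\hat Z_1-I)F(i)\right]}{\sum_{i=1}^{N-1}v_l(i)^2},$$ $$Q_l=\left[(\hat Z_1-\hat Z_0)\hat E\hat E^{D}\right]^{G}\frac{\sum_{i=1}^{N-1}v_l(i)\left[(\hat Z_0-I)F(i)-kG(i)\right]}{\sum_{i=1}^{N-1}v_l(i)^2}.$$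
   Context: The discrete problem is the finite-difference version (space step $h=1/N$, time step $k$, $r=k/h$, $U(i,j)\approx u(ih,jk)$) of $Eu_{tt}-Au_{xx}=0$ on $[0,1]$, $A_1u(0,t)+A_2u_x(0,t)=0$, $B_1u(1,t)+B_2u_x(1,t)=0$, $u(x,0)=f(x)$, $u_t(x,0)=g(x)$; $F,G$ are the discretized initial data ($F(i)$ corresponds to $f(ih)$ and $G(i)$ to $g(ih)$). Drazin inverse: for $M\in\mathbb{C}^{m\times m}$ of index $q$, $M^{D}$ is the unique matrix with $M^{D}MM^{D}=M^{D}$, $M^{D}M=MM^{D}$, $M^{q+1}M^{D}=M^{q}$. $\sigma(M)$ denotes the spectrum of $M$. Generalized inverse: $M^{G}$ denotes a matrix with $MM^{G}M=M$. For $M=(\hat Z_1-\hat Z_0)\hat E\hat E^{D}$ it is the one obtained from a decomposition $M=S\begin{pmatrix}C&0\\0&0\end{pmatrix}S^{-1}$ with $C$ invertible as $M^{G}=S\begin{pmatrix}C^{-1}&0\\0&0\end{pmatrix}S^{-1}$. $\mathcal{G}^{+}$ denotes the Moore–Penrose pseudoinverse of $\mathcal{G}$. Problem (SL): find $\lambda$ and nonzero scalar functions $h(i)$, $0\le i\le N$, with $$h(i+1)-(2-\lambda)h(i)+h(i-1)=0,\quad 0<i<N,$$ $$h(0)+\alpha N\bigl(h(1)-h(0)\bigr)=0,\qquad h(N)+\beta N\bigl(h(N)-h(N-1)\bigr)=0 .$$ It is assumed that $1-\alpha N\ne 0$ and $1+\beta N\neq 0$, so that the boundary conditions express $h(0)$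 as a multiple of $h(1)$ and $h(N)$ as a multiple of $h(N-1)$; then (SL) is the eigenvalue problem for the real symmetric $(N-1)\times(N-1)$ tridiagonal matrix with off-diagonal entries $-1$ and diagonal entries $\frac{2-\alpha N}{1-\alpha N},2,\dots,2,\frac{2+\beta N}{1+\beta N}$. It has $N-1$ eigenvalues $\lambda_l$, $0<l<N$, with eigenfunctions $v_l(i)$ (defined for $0\le i\le N$), which are mutually orthogonal: $\sum_{i=1}^{N-1}v_l(i)v_s(i)=0$ for $l\neq s$. Matrices $\hat Z_0,\hat Z_1$: for a scalar $\rho$, $\hat Z_0=P_+(\hat E^{D}\hat A)\,\hat E\hat E^{D}$ and $\hat Z_1=P_-(\hat E^{D}\hat A)\,\hat E\hat E^{D}$, where $P_\pm(x)$ are polynomials of degree smaller than that of the minimal polynomial of $\hat E^{D}\hat A$ such that $$P_\pm(\hat E^{D}\hat A)=I+\tfrac{\rho}{2}\hat E^{D}\hat A\pm\sqrt{\left(I+\tfrac{\rho}{2}\hat E^{D}\hat A\right)^2-I},$$ the square root being understood in the sense of matrix functions. Stability: with $h$ and $T$ fixed, and $k>0$ such that $kM=T$ with $M\in\mathbb{N}$, a function $U$ on the mesh $\{(ih,jk)\}$ is called stable if its values $U(i,j)$ ($1\le i\le N-1$, $1\le j\le M$) remain bounded independently of the values of $k$ and $M$ with $kM=T$.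
   Formalization: Signs are corrected: P_l uses (Z_1-I)F(i)-kG(i), Q_l uses kG(i)-(Z_0-I)F(i). The initial condition for F (likewise G) is claimed at i only if F(i) lies in the range of E^D A (hatted) and, at i=0 or i=N, F satisfies the boundary condition of (SL) there. *)

(* Defs.v *)
From HB Require Import structures.
From mathcomp Require Import all_boot all_order all_algebra.
From mathcomp Require Import reals complex.
Set Implicit Arguments.
Unset Strict Implicit.
Unset Printing Implicit Defensive.
Import Order.TTheory GRing.Theory Num.Theory.
Local Open Scope ring_scope.
Local Open Scope complex_scope.

(* Square matrices have size m.+1: nothing is lost, since a singular matrix
   (E below) has positive size. *)

Section Matrices.
Variable C : numClosedFieldType.

Definition is_index m (M : 'M[C]_m.+1) (q : nat) : Prop :=
  \rank (M ^+ q.+1) = \rank (M ^+ q) /\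
  forall p, (p < q)%N -> \rank (M ^+ p.+1) <> \rank (M ^+ p).

Definition is_drazin m (M MD : 'M[C]_m.+1) : Prop :=
  exists2 q, is_index M q &
  [/\ MD *m M *m MD = MD, MD *m M = M *m MD & M ^+ q.+1 *m MD = M ^+ q].

Definition adjointmx p q (M : 'M[C]_(p, q)) : 'M[C]_(q, p) :=
  (map_mx Num.conj M)^T.

Definition is_moore_penrose p q (M : 'M[C]_(p, q)) (X : 'M[C]_(q, p)) : Prop :=
  [/\ M *m X *m M = M, X *m M *m X = X,
      adjointmx (M *m X) = M *m X & adjointmx (X *m M) = X *m M].

(* X = S diag(B^-1, 0) S^-1 for some decomposition M = S diag(B, 0) S^-1 with
   B invertible. *)
Definition is_core_ginv m (M X : 'M[C]_m.+1) : Prop :=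
  exists (p q : nat) (e : (p + q = m.+1)%N) (S : 'M[C]_m.+1) (B : 'M[C]_p),
    [/\ S \in unitmx, B \in unitmx,
        M = S *m castmx (e, e) (block_mx B 0 0 (0 : 'M_q)) *m invmx S &
        X = S *m castmx (e, e) (block_mx (invmx B) 0 0 (0 : 'M_q)) *m invmx S].

(* S = f(M) in the sense of Hermite interpolation: S = p(M) for a polynomial p
   that takes, at every eigenvalue z of M, the values jet z j = f^(j)(z) for all
   j smaller than the multiplicity of z in the minimal polynomial of M. *)
Definition is_matrix_function (jet : C -> nat -> C) m (M S : 'M[C]_m.+1) : Prop :=
  exists2 p : {poly C}, S = horner_mx M p &
  forall z j, (j < mup z (mxminpoly M))%N -> p^`(j).[z] = jet z j.

(* j-th derivative at z of the branch of the square root with value s z at z: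
   (1/2)(1/2 - 1)...(1/2 - j + 1) (s z) / z^j. *)
Definition sqrt_jet (s : C -> C) (z : C) (j : nat) : C :=
  s z * (\prod_(i < j) (2%:R^-1 - i%:R)) / z ^+ j.

(* Any branch is allowed, but one and the same for equal eigenvalues.  The
   square root is not differentiable at 0, hence it is defined on the spectrum
   of M only if 0 is at most a simple root of the minimal polynomial. *)
Definition is_matrix_sqrt m (M S : 'M[C]_m.+1) : Prop :=
  (mup 0 (mxminpoly M) <= 1)%N /\
  exists2 s : C -> C, (forall z, s z ^+ 2 = z) &
    is_matrix_function (sqrt_jet s) M S.

(* The matrices Z_0, Z_1 for D = E^D A (hatted) and Pi = E E^D (hatted). *)
Definition is_Z_pair m (rho : C) (D Pi Z0 Z1 : 'M[C]_m.+1) : Prop :=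
  let L := 1%:M + (rho / 2%:R) *: D in
  exists (Pp Pm : {poly C}) (S : 'M[C]_m.+1),
    [/\ (size Pp < size (mxminpoly D))%N /\ (size Pm < size (mxminpoly D))%N,
        is_matrix_sqrt (L ^+ 2 - 1%:M) S,
        horner_mx D Pp = L + S /\ horner_mx D Pm = L - S,
        Z0 = horner_mx D Pp *m Pi & Z1 = horner_mx D Pm *m Pi].

Definition in_range m (M : 'M[C]_m) (x : 'cV[C]_m) : Prop :=
  exists w : 'cV[C]_m, x = M *m w.

End Matrices.

Section Problem.
Variables (R : realType) (m : nat) (N : nat).
Local Notation C := R[i].
Local Notation mat := ('M[C]_m.+1).
Local Notation vec := ('cV[C]_m.+1).

Definition space_step : R := N%:R^-1.

Definition mesh_ratio (k : R) : R := k / space_step.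

Definition SL_eigenfunction (alpha beta lam : R) (v : nat -> R) : Prop :=
  [/\ exists2 i, (i <= N)%N & v i != 0,
      forall i, (0 < i < N)%N -> v i.+1 - (2%:R - lam) * v i + v i.-1 = 0,
      v 0%N + alpha * N%:R * (v 1%N - v 0%N) = 0 &
      v N + beta * N%:R * (v N - v N.-1) = 0].

Definition SL_eigensystem (alpha beta : R) (lam : nat -> R)
    (v : nat -> nat -> R) : Prop :=
  (forall l, (0 < l < N)%N -> SL_eigenfunction alpha beta (lam l) (v l)) /\
  (forall l s, (0 < l < N)%N -> (0 < s < N)%N -> l <> s ->
     \sum_(1 <= i < N) v l i * v s i = 0).

(* The boundary conditions of (SL) for a vector-valued mesh function W, each
   imposed only if i is the corresponding end point; void for 0 < i < N. *)
Definition SL_boundary_at (alpha beta : R) (W : nat -> vec) (i : nat) : Prop :=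
  (i = 0%N -> W 0%N + (alpha * N%:R)%:C *: (W 1%N - W 0%N) = 0) /\
  (i = N -> W N + (beta * N%:R)%:C *: (W N - W N.-1) = 0).

Definition rho (lam : nat -> R) (k : R) (l : nat) : R :=
  - mesh_ratio k ^+ 2 * lam l.

Definition admissible_step (D : mat) (lam : nat -> R) (k : R) : Prop :=
  0 < k /\
  forall l, (0 < l < N)%N ->
    (forall d : C, eigenvalue D d -> d != 0 ->
       (rho lam k l)%:C * d * (1 + (rho lam k l)%:C / 4%:R * d) != 0) /\
    rho lam k l <=
      mesh_ratio k ^+ 2 * \big[Num.max/0]_(1 <= s < N) `|lam s|.

Definition difference_equation (A E : mat) (k : R) (U : nat -> nat -> vec) :
    Prop :=
  let r2 := (mesh_ratio k ^+ 2)%:C in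
  forall i j, (0 < i < N)%N -> (0 < j)%N ->
    r2 *: (A *m (U i.+1 j + U i.-1 j))
    + 2%:R *: ((E - r2 *: A) *m U i j)
    - E *m (U i j.+1 + U i j.-1) = 0.

Definition left_boundary (A1 A2 : mat) (U : nat -> nat -> vec) : Prop :=
  forall j, (0 < j)%N ->
    A1 *m U 0%N j + N%:R *: (A2 *m (U 1%N j - U 0%N j)) = 0.

Definition right_boundary (B1 B2 : mat) (U : nat -> nat -> vec) : Prop :=
  forall j, (0 < j)%N ->
    B1 *m U N j + N%:R *: (B2 *m (U N j - U N.-1 j)) = 0.

(* U k is a mesh function for the time step k. *)
Definition stable (T : R) (adm : R -> Prop) (U : R -> nat -> nat -> vec) :
    Prop :=
  exists B : R, forall (k : R) (M : nat),
    adm k -> k * M%:R = T ->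
    forall i j a, (0 < i < N)%N -> (0 < j <= M)%N -> `|U k i j a 0| <= B%:C.

Definition bounded_mesh (W : nat -> vec) : Prop :=
  exists B : R, forall i a, (i <= N)%N -> `|W i a 0| <= B%:C.

(* P_l and Q_l solve the initial conditions P + Q = F and
   (Z0 - I) P + (Z1 - I) Q = k G for the l-th coefficients of F and G, so that
   (Z1 - Z0) P = (Z1 - I) F - k G and (Z1 - Z0) Q = k G - (Z0 - I) F. *)
Definition coefP (k : R) (Z1 MG : mat) (F G : nat -> vec) (vl : nat -> R) : vec :=
  MG *m (((\sum_(1 <= i < N) vl i ^+ 2)%:C)^-1 *:
    \sum_(1 <= i < N) (vl i)%:C *: ((Z1 - 1%:M) *m F i - k%:C *: G i)).

Definition coefQ (k : R) (Z0 MG : mat) (F G : nat -> vec) (vl : nat -> R) : vec :=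
  MG *m (((\sum_(1 <= i < N) vl i ^+ 2)%:C)^-1 *:
    \sum_(1 <= i < N) (vl i)%:C *: (k%:C *: G i - (Z0 - 1%:M) *m F i)).

Definition series_solution (Pi : mat) (Z0 Z1 MG : nat -> mat)
    (F G : nat -> vec) (v : nat -> nat -> R) (k : R) (i j : nat) : vec :=
  \sum_(1 <= l < N) (v l i)%:C *:
    (Z0 l ^+ j *m Pi *m coefP k (Z1 l) (MG l) F G (v l)
     + Z1 l ^+ j *m Pi *m coefQ k (Z0 l) (MG l) F G (v l)).

End Problem.

(* Main.v *)
Require Import Defs.
From HB Require Import structures.
From mathcomp Require Import all_boot all_order all_algebra.
From mathcomp Require Import ring zify.
From mathcomp Require Import reals complex.
From mathcomp Require Import boolp sequences exp.
Set Implicit Arguments.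
Unset Strict Implicit.
Unset Printing Implicit Defensive.
Import Order.TTheory GRing.Theory Num.Theory.
Local Open Scope ring_scope.
Local Open Scope complex_scope.

(* Z_0, Z_1 and the generalized inverses are polynomials in D = E^D A, times the
   projection Pi = E E^D (hatted), which fixes F and G.  Separating variables, U
   is the sum of v_l(i) W_l(j), where W_l combines the powers of the commuting
   solutions Z_0, Z_1 of Z^2 - (2 + rho D) Z + 1 = 0 on the range of Pi, hence
   solves W_l(j+1) + W_l(j-1) = (2 + rho D) W_l(j); the boundary conditions hold
   because D preserves the kernel of calG.  By completeness of the v_l, the
   initial conditions hold up to the projection onto the range of D.

   For stability, write rho = tau^2 with tau = k theta, and let S = tau S_1 be
   the square root occurring in Z_0, Z_1, so that S_1^2 = D + (rho/4) D^2.  The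
   branch may depend on k, but S_1 is a polynomial in D without constant term;
   on a triangular form of D, Parlett's recurrence then bounds it uniformly for
   small k.  Hence Z_0, Z_1 are 1 + O(k) on the range of Pi, with their powers
   up to T/k bounded by an exponential, and k [(Z_1 - Z_0) Pi]^G is bounded. *)

(** * Square roots of matrices as matrix functions *)

Section PolynomialMultiplicity.
Variable C : numClosedFieldType.
Implicit Types (p q w : {poly C}) (z : C).

(** By induction on [n] for all [q] at once: the derivative of [q ('X - z)^(n+1)] is [q' ('X - z)]
    times [('X - z)^n], whose [n]-th derivative vanishes at [z], plus [n+1] copies of
    [q ('X - z)^n]. *)
Lemma horner_derivn_XsubC_exp q z n :
  (q * ('X - z%:P) ^+ n)^`(n).[z] = q.[z] *+ n`!.
Proof.
elim: n q => [|n IHn] q; first by rewrite expr0 mulr1 derivn0.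
rewrite derivSn derivM deriv_exp derivXsubC mul1r /= derivnD hornerD.
rewrite mulrnAr -mulrnAl exprS mulrA !IHn hornerM hornerXsubC subrr mulr0
  mul0rn add0r.
by rewrite hornerMn -mulrnA factS.
Qed.

(** Once [p = q ('X - z)^n], the [n]-th derivative of [p] at [z] is [n! q(z)]; in characteristic
    zero its vanishing yields one more factor. *)
Lemma dvdp_XsubC_exp_derivn p z n :
  (forall j, (j < n)%N -> p^`(j).[z] = 0) -> ('X - z%:P) ^+ n %| p.
Proof.
elim: n => [|n IHn] p0; first by rewrite expr0 dvd1p.
have /dvdpP [q def_p] := IHn (fun j ltjn => p0 j (ltnW ltjn)).
have := p0 n (leqnn _); rewrite def_p horner_derivn_XsubC_exp => /eqP.
rewrite mulrn_eq0 eqn0Ngt fact_gt0 /= => /factor_theorem [q1 ->].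
by rewrite -mulrA -exprS dvdp_mull.
Qed.

(** Over a closed field, linear factors common to [p] and [q] can be removed one at a time, which
    preserves the comparison of multiplicities. *)
Lemma dvdp_mup_closed p q : p != 0 -> q != 0 ->
  (forall z, (mup z p <= mup z q)%N) -> p %| q.
Proof.
have [n] := ubnP (size p); elim: n p q => // n IHn p q ltpn p0 q0 le_mup.
have [/eqP sp1|sp1] := boolP (size p == 1%N).
  by have /size_poly1P [c c0 ->] := introT eqP sp1;
     rewrite -alg_polyC dvdpZl // dvd1p.
have [z /factor_theorem [p1 def_p]] := closed_rootP _ sp1.
have p10 : p1 != 0 by apply: contraNneq p0 => p10; rewrite def_p p10 mul0r.
have Xz0 : 'X - z%:P != 0 :> {poly C} by rewrite polyXsubC_eq0.
have /dvdpP [q1 def_q] : 'X - z%:P %| q.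
  rewrite XsubC_dvd // (leq_trans _ (le_mup z)) // -XsubC_dvd // def_p.
  exact: dvdp_mull.
have q10 : q1 != 0 by apply: contraNneq q0 => q10; rewrite def_q q10 mul0r.
rewrite def_p def_q dvdp_mul2r //; apply: IHn => // [|y].
  move: ltpn; rewrite def_p size_mul // size_XsubC.
  by rewrite addn2 /= ltnS.
have := le_mup y; rewrite def_p def_q.
have [->|neq_yz] := eqVneq y z; last first.
  by rewrite !mupMl // root_XsubC.
have mupS r : r != 0 -> mup z (r * ('X - z%:P)) = (mup z r).+1.
  move=> r0; have h k : (k < mup z (r * ('X - z%:P)))%N = (k <= mup z r)%N.
    by rewrite !mup_geq ?mulf_neq0 // exprSr dvdp_mul2r.
  apply/eqP; rewrite eqn_leq h leqnn andbT.
  by case def_k: (mup z _) => [|k] //; rewrite ltnS -h def_k.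
by rewrite !mupS.
Qed.

End PolynomialMultiplicity.

(** * From jets at the eigenvalues to identities between matrices *)

Section MatrixSquareRoot.
Variables (C : numClosedFieldType) (m : nat).
Implicit Types (M S : 'M[C]_m.+1) (p q w : {poly C}) (z : C).

Lemma derivn_mulX p n : ('X * p)^`(n.+1) = 'X * p^`(n.+1) + p^`(n) *+ n.+1.
Proof.
by have := derivnMXaddC n p 0; rewrite addr0 [p * 'X]mulrC => ->; rewrite addrC
  mulrC.
Qed.

(* The jet of a branch [p] of the square root satisfies [2 X p' = p], so that
   [w = p^2 - X] satisfies [X w' - w = p (2 X p' - p)], which forces the
   multiplicity of each root [z != 0] of [w] up to [n]. *)
Lemma sqrt_jet_dvdp (s : C -> C) p z n : z != 0 -> s z ^+ 2 = z ->
    (forall j, (j < n)%N -> p^`(j).[z] = sqrt_jet s z j) ->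
  ('X - z%:P) ^+ n %| p ^+ 2 - 'X.
Proof.
move=> z0 sz jets; case: n jets => [|n] jets; first by rewrite expr0 dvd1p.
pose g := 'X * p^`() *+ 2 - p.
(* Differentiation costs one order: [p] has [n+1] prescribed jets, and the relation
   [z p^(j+1)(z) = (1/2 - j) p^(j)(z)] between consecutive ones annihilates the first [n] jets of
   [g]. *)
have dvg : ('X - z%:P) ^+ n %| g.
  apply: dvdp_XsubC_exp_derivn => j ltjn.
  have jetS : p^`(j.+1).[z] * z = p^`(j).[z] * (2%:R^-1 - j%:R).
    rewrite !jets //; last exact: ltnW.
    rewrite /sqrt_jet big_ord_recr /= exprSr invfM -!mulrA; congr (_ * _).
    by rewrite mulVf // mulr1; congr (_ * _); rewrite mulrC.
  have -> : g^`(j) = ('X * p^`(j.+1) + p^`(j) *+ j) *+ 2 - p^`(j).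
    rewrite /g derivnB derivnMn; congr (_ *+ 2 - _).
    case: (j) => [|i]; first by rewrite addr0.
    by rewrite derivn_mulX -!derivSn.
  rewrite hornerD hornerN !hornerMn hornerD hornerMn hornerM hornerX.
  rewrite [z * _]mulrC jetS mulrBr mulr_natr subrK -mulr_natr divfK ?subrr //.
  by rewrite pnatr_eq0.
set w := p ^+ 2 - 'X.
have Xw : 'X * w^`() - w = p * g.
  rewrite /w /g derivB derivX expr2 derivM -mulr_natr; ring.
suff dvw a : (a <= n)%N -> ('X - z%:P) ^+ a.+1 %| w by apply: dvw.
elim: a => [|a IHa] ltan.
  rewrite expr1 dvdp_XsubCl /root /w !hornerE.
  have := jets 0%N isT; rewrite derivn0 /sqrt_jet big_ord0 expr0 divr1 mulr1.
  by move=> ->; rewrite sz subrr.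
(* For [w = u ('X - z)^(a+1)], the polynomial ['X w' - w] is [(a+1) 'X u ('X - z)^a] modulo
   [('X - z)^(a+1)]; hence ['X - z] divides ['X u], and then [u] because [z != 0]. *)
have /dvdpP [u def_w] := IHa (ltnW ltan).
have : ('X - z%:P) ^+ a.+1 %| 'X * w^`() - w.
  by rewrite Xw dvdp_mull // (dvdp_trans _ dvg) // dvdp_exp2l.
have -> : 'X * w^`() - w =
    ('X * u *+ a.+1 + ('X - z%:P) * ('X * u^`() - u)) * ('X - z%:P) ^+ a.
  rewrite def_w derivM deriv_exp derivXsubC exprS -mulr_natr -[_ *+
    a.+1]mulr_natr /=.
  ring.
rewrite exprS dvdp_mul2r ?expf_neq0 ?polyXsubC_eq0 //.
rewrite dvdp_addl ?dvdp_mulr // dvdp_XsubCl /root hornerMn hornerM hornerX.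
rewrite mulrn_eq0 /= mulf_eq0 (negPf z0) /= => /factor_theorem [u1 def_u].
by rewrite def_w def_u -mulrA -exprS dvdp_mull.
Qed.

(** The minimal polynomial divides [p^2 - 'X], root by root: the jets settle the nonzero roots, and
    at 0, at most a simple root, the value of [p] is enough. *)
Lemma matrix_sqrt_sqr M S : is_matrix_sqrt M S -> S *m S = M.
Proof.
move=> [mup0 [s s2 [p -> jets]]].
apply/eqP; rewrite -subr_eq0 -{3}[M]horner_mx_X mulmxE -expr2 -rmorphXn /=
  -rmorphB /=.
rewrite -dvd_mxminpoly.
have [->|w0] := eqVneq (p ^+ 2 - 'X) 0; first exact: dvdp0.
apply: dvdp_mup_closed => // [|z]; first exact/monic_neq0/mxminpoly_monic.
rewrite mup_geq //; have [z0|z0] := eqVneq z 0; last first.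
  exact: sqrt_jet_dvdp (jets z).
rewrite z0; case: (mup 0 _) mup0 (jets 0) => [|[|//]] _ jet0.
  by rewrite expr0 dvd1p.
rewrite expr1 dvdp_XsubCl /root !hornerE -[p.[0]]/(p^`(0).[0]) jet0 //.
by rewrite /sqrt_jet big_ord0 expr0 divr1 mulr1 s2 subrr.
Qed.

Lemma horner_mx_mulX M p : horner_mx M (p * 'X) = M * horner_mx M p.
Proof. by rewrite mulrC rmorphM /= horner_mx_X. Qed.

Lemma poly_split0 p : exists q, p = q * 'X + p.[0]%:P.
Proof.
have /factor_theorem [q def_q] : root (p - p.[0]%:P) 0.
  by rewrite /root !hornerE subrr.
by exists q; rewrite subr0 in def_q; rewrite -def_q subrK.
Qed.

(** A singular [M] has the eigenvalue 0, where every branch takes the value 0; the interpolating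
    polynomial thus has no constant term. *)
Lemma matrix_sqrt_mul_poly M S : is_matrix_sqrt M S -> M \notin unitmx ->
  exists p, S = M * horner_mx M p.
Proof.
move=> [mup0 [s s2 [p -> jets]]] M_sing; have [q def_p] := poly_split0 p.
exists q; rewrite -horner_mx_mulX {1}def_p rmorphD /= horner_mx_C.
suff -> : p.[0] = 0 by rewrite raddf0 addr0.
rewrite -[p.[0]]/(p^`(0).[0]) jets; last first.
  rewrite -XsubC_dvd ?monic_neq0 ?mxminpoly_monic // dvdp_XsubCl.
  rewrite -eigenvalue_root_min; apply: contraNT M_sing.
  by rewrite /eigenvalue /eigenspace raddf0 subr0 negbK kermx_eq0 row_free_unit.
rewrite /sqrt_jet; have /eqP := s2 0; rewrite expf_eq0 /= => /eqP ->.
by rewrite !mul0r.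
Qed.

(** This says that [M] has index at most one. As 0 is at most a simple root of the minimal
    polynomial, [M q(M) = 0] for some [q] with [q(0) != 0], and the constant term can be solved
    for. *)
Lemma matrix_sqrt_index M S : is_matrix_sqrt M S ->
  exists p, M = M * M * horner_mx M p.
Proof.
move=> [mup0 _]; have mp0 := monic_neq0 (mxminpoly_monic M).
have [a [q qP def_mp]] := multiplicity_XsubC (mxminpoly M) 0.
rewrite mp0 /= subr0 in qP def_mp.
have le_a1 : (a <= 1)%N.
  apply: leq_trans mup0; rewrite mup_geq //.
  by rewrite subr0 def_mp dvdp_mull.
have Mq : M * horner_mx M q = 0.
  rewrite -horner_mx_mulX; apply/eqP; rewrite -dvd_mxminpoly def_mp.
  by apply: dvdp_mul => //; case: (a) le_a1 => [|[|]] // _; rewrite ?expr0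
    ?dvd1p ?expr1.
have [q1 def_q] := poly_split0 q.
exists (- q.[0]^-1 *: q1).
move: Mq; rewrite {1}def_q rmorphD /= horner_mx_C horner_mx_mulX mulrDr mulrA.
move/eqP; rewrite addr_eq0 -mulmxE mul_mx_scalar mulmxE => /eqP Mq1.
rewrite linearZ /= -scalerAr Mq1 scaleNr scalerN opprK scalerA mulVf ?scale1r
  //.
Qed.

End MatrixSquareRoot.

(** * Group inverses *)

Section GroupInverse.
Variables (C : numClosedFieldType) (m : nat).
Implicit Types (D M S X Z : 'M[C]_m.+1) (p q : {poly C}) (c : C).

(** These equations characterise the Drazin inverse in index at most one. Unlike [is_core_ginv],
    they refer to no decomposition. *)
Definition group_inverse M X : Prop :=
  [/\ M * X * M = M, X * M * X = X & M * X = X * M].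

Lemma core_ginv_group_inverse M X : is_core_ginv M X -> group_inverse M X.
Proof.
case=> p [q [e [S [B [Su Bu -> ->]]]]].
set J := block_mx B _ _ _; set K := block_mx (invmx B) _ _ _.
have [JKJ KJK JK] : [/\ J *m K *m J = J, K *m J *m K = K & J *m K = K *m J].
  rewrite /J /K !mulmx_block !(mulmx0, mul0mx, addr0, mulmxV, mulVmx) //.
  by rewrite !mul1mx.
have castM (n : nat) (e' : (p + q = n)%N) (U V : 'M[C]_(p + q)) :
    castmx (e', e') U *m castmx (e', e') V = castmx (e', e') (U *m V).
  by case: n / e'; rewrite !castmx_id.
have conjM (U V : 'M[C]_m.+1) :
    (S *m U *m invmx S) * (S *m V *m invmx S) = S *m (U *m V) *m invmx S.
  by rewrite -mulmxE !mulmxA mulmxKV.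
by split; rewrite !conjM !castM ?JKJ ?KJK ?JK.
Qed.

Lemma group_inverse_uniq M X Y :
  group_inverse M X -> group_inverse M Y -> X = Y.
Proof.
move=> [MXM XMX MX] [MYM YMY MY].
have XM : X * M = M * Y.
  by rewrite -{1}MYM -[M * Y * M]mulrA -MY !mulrA -MX -[in RHS]MXM.
by rewrite -XMX XM MY -mulrA MX XM mulrA YMY.
Qed.

(** Let [q] be the cofactor of the power of ['X] in the minimal polynomial. The idempotent [X M]
    equals its own powers, so it annihilates [q(M)]; since [q(0) != 0], this expresses [X M], and
    then [X], through [M]. *)
Lemma group_inverse_poly M X : group_inverse M X ->
  exists q, X = horner_mx M q.
Proof.
move=> [MXM XMX MX].
have [a [q qP def_mp]] := multiplicity_XsubC (mxminpoly M) 0.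
rewrite monic_neq0 ?mxminpoly_monic //= subr0 in qP def_mp.
have eq0 : X * M * horner_mx M q = 0.
  have idem k : (X * M) ^+ k.+1 = X * M.
    elim: k => // k IHk; rewrite exprS IHk mulrA XMX //.
  rewrite -(idem a) exprMn_comm; last by rewrite /GRing.comm MX.
  have Mq : M ^+ a * horner_mx M q = 0.
    by rewrite -[in M ^+ a](horner_mx_X M) -rmorphXn -rmorphM /= mulrC -def_mp
      mx_root_minpoly.
  by rewrite -mulrA [M ^+ a.+1]exprS -[M * _ * _]mulrA Mq !mulr0.
have [q1 def_q] := poly_split0 q.
have Mq1 : M * horner_mx M q1 = - q.[0] *: (X * M).
  move: eq0; rewrite {1}def_q rmorphD /= horner_mx_C horner_mx_mulX mulrDr
    mulrA.
  rewrite -{1}MX MXM -mulmxE mul_mx_scalar => /eqP.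
  by rewrite addr_eq0 scaleNr => /eqP.
have Xq1 : X * M * horner_mx M q1 = - q.[0] *: X.
  by rewrite -mulrA Mq1 -scalerAr -MX mulrA XMX.
(* Indeed [M q1(M)^2 = - q(0) X M q1(M) = q(0)^2 X]. *)
exists ((q.[0] ^- 2) *: (q1 * q1 * 'X)).
rewrite linearZ /= horner_mx_mulX rmorphM /= mulrA Mq1 -scalerAl Xq1 !scalerA.
by rewrite -mulrA mulrNN expr2 mulVf ?scale1r ?mulf_neq0.
Qed.

Lemma horner_mx_comp D p q : horner_mx (horner_mx D q) p = horner_mx D (p \Po
  q).
Proof.
elim/poly_ind: p => [|p c IHp]; first by rewrite comp_poly0 !raddf0.
rewrite comp_polyD comp_polyC comp_polyM comp_polyX !rmorphD !rmorphM /= !IHp.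
by rewrite horner_mx_X !horner_mx_C.
Qed.

Lemma horner_mx_affine D c : horner_mx D (1 + c%:P * 'X) = 1%:M + c *: D.
Proof.
by rewrite rmorphD rmorph1 rmorphM /= horner_mx_X horner_mx_C -mulmxE
  mul_scalar_mx.
Qed.

Lemma unitmx_no_eigenvalue D c : c != 0 ->
  ~~ eigenvalue D (- c^-1) -> 1%:M + c *: D \in unitmx.
Proof.
move=> c0; rewrite /eigenvalue negbK kermx_eq0 row_free_unit => Du.
have -> : 1%:M + c *: D = c *: (D - (- c^-1)%:M).
  by rewrite raddfN opprK scalerDr addrC scale_scalar_mx mulfV.
by rewrite unitmxZ ?unitfE.
Qed.

(** Here [L^2 - 1 = rho D F], which is singular with [D]: its square root is a polynomial in [D]
    without constant term. Its index is at most one, and this passes to [D] by cancelling the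
    invertible [F]. *)
Lemma Z_pair_structure rho D Pi Z0 Z1 : rho != 0 -> D \notin unitmx ->
    (forall d, eigenvalue D d -> d != 0 -> rho * d * (1 + rho / 4%:R * d) != 0)
      ->
    is_Z_pair rho D Pi Z0 Z1 ->
  let F := 1%:M + (rho / 4%:R) *: D in let L := 1%:M + (rho / 2%:R) *: D in
  F \in unitmx /\
  exists w u, let S := D * horner_mx D w in
    [/\ D = D * D * horner_mx D u, S * S = rho *: (D * F),
        Z0 = (L + S) * Pi & Z1 = (L - S) * Pi].
Proof.
move=> rho0 Dsing specD [Pp [Pm [S [_ sqS [ZL0 ZL1] -> ->]]]].
rewrite {}ZL0 {}ZL1 => F L.
(* If [F] were singular, [-4 / rho] would be a nonzero eigenvalue of [D] excluded by the spectral
   condition. *)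
have Fu : F \in unitmx.
  have c0 : rho / 4%:R != 0 by rewrite mulf_neq0 ?invr_eq0 ?pnatr_eq0.
  apply: unitmx_no_eigenvalue => //; apply/negP => /specD.
  rewrite oppr_eq0 invr_eq0 c0 => /(_ isT).
  by rewrite !mulrN mulfV // subrr mulr0 eqxx.
split=> //.
pose f := 1 + (rho / 4%:R)%:P * 'X.
have defF : F = horner_mx D f by rewrite horner_mx_affine.
have defM : rho *: (D * F) = horner_mx D (rho *: ('X * f)).
  by rewrite linearZ /= rmorphM /= horner_mx_X -defF.
have M_DF : L ^+ 2 - 1%:M = rho *: (D * F).
  rewrite defM /L -horner_mx_affine -rmorphXn -[1%:M](rmorph1 (horner_mx D)).
  rewrite -rmorphB -mul_polyC /=; congr (horner_mx D _); rewrite /f.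
  have -> : rho / 2%:R = rho / 4%:R *+ 2 by field.
  have {2}-> : rho = rho / 4%:R *+ 4 by field.
  by rewrite !raddfMn /=; ring.
rewrite {}M_DF in sqS.
have DFsing : rho *: (D * F) \notin unitmx.
  by rewrite unitmxZ ?unitfE // -mulmxE unitmx_mul (negPf Dsing).
have [w1 def_S] := matrix_sqrt_mul_poly sqS DFsing.
have [u1 def_M] := matrix_sqrt_index sqS.
have S2 := matrix_sqrt_sqr sqS.
have comDF : D * F = F * D by rewrite defF; apply: comm_mx_horner.
exists (rho *: (f * (w1 \Po (rho *: ('X * f))))), (rho *: (f * (u1 \Po (rho *:
  ('X * f))))).
have <- : S = D * horner_mx D (rho *: (f * (w1 \Po (rho *: ('X * f))))).
  rewrite def_S defM horner_mx_comp -rmorphM /= -{2}[D]horner_mx_X -rmorphM /=.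
  by rewrite -!scalerAl -scalerAr mulrA.
split=> //.
have Fr : F \is a GRing.unit by [].
apply: (mulIr Fr); apply: (scalerI rho0); rewrite {1}def_M {3}defM
  horner_mx_comp.
rewrite linearZ /= rmorphM /= -defF -!scalerAl -!scalerAr -!scalerAl; congr (_
  *: (_ *: _)).
have comF q : F * horner_mx D q = horner_mx D q * F.
  by rewrite defF -!rmorphM mulrC.
by rewrite -[_ * F in RHS]mulrA -[_ * F in RHS]mulrA -comF !mulrA -[D * F *
  D]mulrA -comDF !mulrA.
Qed.

End GroupInverse.

(** * Bounded square roots of triangular matrices *)

Section EntryNorm.
Variable C : numClosedFieldType.

(** A submultiplicative norm with values among the nonnegative elements of [C] itself, so that it is
    available over any closed numeric field. *)
Definition mxnorm p q (M : 'M[C]_(p, q)) : C := \sum_i \sum_j `|M i j|.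

Lemma mxnorm_ge0 p q (M : 'M[C]_(p, q)) : 0 <= mxnorm M.
Proof. by apply: sumr_ge0 => i _; apply: sumr_ge0. Qed.

Lemma mxnorm_entry p q (M : 'M[C]_(p, q)) i j : `|M i j| <= mxnorm M.
Proof.
rewrite /mxnorm (bigD1 i) //= (bigD1 j) //= -addrA lerDl addr_ge0 //.
  by apply: sumr_ge0.
by apply: sumr_ge0 => k _; apply: sumr_ge0.
Qed.

Lemma mxnorm_le p q (M : 'M[C]_(p, q)) K : (forall i j, `|M i j| <= K) ->
  mxnorm M <= K *+ q *+ p.
Proof.
move=> leK; apply: le_trans (_ : \sum_(i < p) \sum_(j < q) K <= _).
  by apply: ler_sum => i _; apply: ler_sum => j _.
by rewrite !sumr_const !card_ord.
Qed.

Lemma mxnormD p q (M M' : 'M[C]_(p, q)) : mxnorm (M + M') <= mxnorm M + mxnorm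
  M'.
Proof.
rewrite /mxnorm -big_split; apply: ler_sum => i _.
by rewrite -big_split; apply: ler_sum => j _; rewrite mxE ler_normD.
Qed.

Lemma mxnormZ p q c (M : 'M[C]_(p, q)) : mxnorm (c *: M) = `|c| * mxnorm M.
Proof.
rewrite /mxnorm mulr_sumr; apply: eq_bigr => i _.
by rewrite mulr_sumr; apply: eq_bigr => j _; rewrite mxE normrM.
Qed.

Lemma mxnormM p q r (M : 'M[C]_(p, q)) (M' : 'M[C]_(q, r)) :
  mxnorm (M *m M') <= mxnorm M * mxnorm M'.
Proof.
rewrite {1 2}/mxnorm mulr_suml; apply: ler_sum => i _.
apply: le_trans (_ : \sum_j \sum_k `|M i k| * `|M' k j| <= _).
  apply: ler_sum => j _; rewrite mxE (le_trans (ler_norm_sum _ _ _)) //.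
  by apply: ler_sum => k _; rewrite normrM.
rewrite exchange_big mulr_suml /=; apply: ler_sum => k _.
rewrite -mulr_sumr ler_wpM2l // /mxnorm [leRHS](bigD1 k) //= lerDl.
by apply: sumr_ge0 => l _; apply: sumr_ge0.
Qed.

End EntryNorm.

Section TriangularSquareRoot.
Variables (C : numClosedFieldType) (m : nat).
Implicit Types (T S M : 'M[C]_m.+1) (p u w : {poly C}) (a b c x y : C).

Lemma trigmxM M T : is_trig_mx M -> is_trig_mx T ->
  is_trig_mx (M * T) /\ forall i, (M * T) i i = M i i * T i i.
Proof.
move=> /is_trig_mxP trM /is_trig_mxP trT; split.
  apply/is_trig_mxP => i j ltij; rewrite -mulmxE mxE big1 // => k _.
  have [/trM ->|leki] := ltnP i k; first by rewrite mul0r.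
  by rewrite trT ?mulr0 // (leq_ltn_trans leki).
move=> i; rewrite -mulmxE mxE (bigD1 i) //= big1 ?addr0 // => k.
rewrite -(inj_eq val_inj) /= neq_ltn => /orP[/trT ->|/trM ->].
  by rewrite mulr0.
by rewrite mul0r.
Qed.

Lemma trigmx_horner T p : is_trig_mx T ->
  is_trig_mx (horner_mx T p) /\ forall i, horner_mx T p i i = p.[T i i].
Proof.
move=> trT; elim/poly_ind: p => [|p c [trp diagp]].
  by rewrite raddf0; split=> [|i]; rewrite ?mx0_is_trig // mxE horner0.
rewrite rmorphD rmorphM /= horner_mx_X horner_mx_C.
have [trM diagM] := trigmxM trp trT; split.
  apply/is_trig_mxP => i j ltij; rewrite mxE (is_trig_mxP trM) // add0r.
  by rewrite (is_trig_mxP (scalar_mx_is_trig _ _)).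
by move=> i; rewrite mxE diagM diagp !mxE !hornerE eqxx mulr1n.
Qed.

(** This controls the divisor in Parlett's recurrence. If [x != y], use [(a + b) (a - b) = (x - y)
    (1 + c x + c y)]; if [x = y], then [a = b] and [a^2 = x (1 + c x)]. In both cases the factor
    near 1 has modulus at least 1/2. Each summand of the constant serves one case; a division by
    zero yields 0. *)
Lemma sqrt_sum_bound (B x y a b c : C) : 0 <= B -> `|a| <= B -> `|b| <= B ->
    `|c * x| <= 4%:R^-1 -> `|c * y| <= 4%:R^-1 ->
    a ^+ 2 = x + c * x ^+ 2 -> b ^+ 2 = y + c * y ^+ 2 ->
    (x = y -> a = b) -> (x != 0) || (y != 0) ->
  1 <= (B * 4%:R / `|x - y| + B / `|x|) * `|a + b|.
Proof.
move=> B0 leaB lebB cx cy a2 b2 eqab nz.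
have norm1D (z : C) : `|z| <= 2%:R^-1 -> 2%:R^-1 <= `|1 + z|.
  move=> le_z; have := lerB_normD 1 z; rewrite normr1; apply: le_trans.
  by rewrite lerBrDr -lerBrDl (le_trans le_z) // [X in _ <= X](_ : _ = 2%:R^-1)
    //; field.
have [eq_xy|neq_xy] := eqVneq x y.
  rewrite -eq_xy subrr normr0 invr0 mulr0 add0r -(eqab eq_xy).
  have x0 : x != 0 by move: nz; rewrite -eq_xy orbb.
  have nx : 0 < `|x| by rewrite normr_gt0.
  rewrite mulrAC ler_pdivlMr // mul1r -mulr2n normrMn.
  have: `|x| * 2%:R^-1 <= B * `|a|.
    apply: le_trans (_ : `|a ^+ 2| <= _); last by rewrite normrX expr2
      ler_wpM2r.
    rewrite a2 (_ : _ + _ = x * (1 + c * x)) ?normrM; last by ring.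
    rewrite ler_pM2l // norm1D // (le_trans cx) // lef_pV2 ?ler_nat ?posrE
      ?ltr0n //.
  by rewrite ler_pdivrMr ?ltr0n // -mulrA mulr_natr.
have nxy : 0 < `|x - y| by rewrite normr_gt0 subr_eq0.
apply: le_trans (_ : B * 4%:R / `|x - y| * `|a + b| <= _); last first.
  by rewrite ler_wpM2r // lerDl divr_ge0.
rewrite mulrAC ler_pdivlMr // mul1r.
have : `|x - y| * 2%:R^-1 <= `|a + b| * (B + B).
  apply: le_trans (_ : `|a + b| * `|a - b| <= _); last first.
    by rewrite ler_wpM2l // (le_trans (ler_normB _ _)) // lerD.
  rewrite -normrM (_ : (a + b) * (a - b) = (x - y) * (1 + (c * x + c * y)));
    last first.
    by rewrite mulrC -subr_sqr a2 b2; ring.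
  rewrite normrM ler_pM2l // norm1D // (le_trans (ler_normD _ _)) //.
  by rewrite (le_trans (lerD cx cy)) // [leLHS](_ : _ = 2%:R^-1) //; field.
rewrite ler_pdivrMr ?ltr0n // => /le_trans; apply.
by rewrite [leLHS](_ : _ = B * 4%:R * `|a + b|) //; ring.
Qed.

(* Parlett's recurrence: [(S_ii + S_jj) S_ij] is [(S^2)_ij] up to terms closer
   to the diagonal.  When [T_ii = T_jj = 0] it is void, and [S = S e] is used
   instead, for the idempotent [e = T u(T)] with [e_jj = 0]. *)
Lemma trigmx_sqrt_bounded T u : is_trig_mx T -> T = T * T * horner_mx T u ->
  exists K e0 : C, [/\ 0 <= K, 0 < e0 & forall c w, `|c| <= e0 ->
    let S := T * horner_mx T w in S * S = T + c *: (T * T) ->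
    forall i j, `|S i j| <= K].
Proof.
move=> trT Tidx; pose e := T * horner_mx T u; pose t := 1 + mxnorm T.
have t1 : 1 <= t by rewrite lerDl mxnorm_ge0.
have t0 : 0 < t := lt_le_trans ltr01 t1.
(* A bound for [|S i i|]: its square is at most [2 t], and [2 t <= (2 t)^2] because [t >= 1]. *)
pose B := t *+ 2.
pose kap i j := B * 4%:R / `|T i i - T j j| + B / `|T i i|.
pose Kap := \sum_i \sum_j kap i j.
have B0 : 0 <= B by rewrite mulrn_wge0 // ltW.
have kap0 i j : 0 <= kap i j by rewrite addr_ge0 ?divr_ge0 ?mulr_ge0 ?ler0n.
have leKap i j : kap i j <= Kap.
  rewrite /Kap (bigD1 i) //= (bigD1 j) //= -addrA lerDl addr_ge0 //.
    exact: sumr_ge0.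
  by apply: sumr_ge0 => k _; apply: sumr_ge0.
have Kap0 : 0 <= Kap by apply: le_trans (kap0 ord0 ord0) (leKap _ _).
have [tru diagu] := trigmx_horner u trT.
have [tre diage] : is_trig_mx e /\ forall i, e i i = T i i * u.[T i i].
  by have [? de] := trigmxM trT tru; split=> // i; rewrite de diagu.
have comT p : T * horner_mx T p = horner_mx T p * T.
  by apply: comm_mx_horner.
(* Induction on the distance [n] to the diagonal. The threshold for [c] gives [|c T i i| <= 1/4], as
   [sqrt_sum_bound] requires. *)
suff bounds n : exists2 K : C, 0 <= K & forall c w, `|c| <= (t *+ 4)^-1 ->
    let S := T * horner_mx T w in S * S = T + c *: (T * T) ->
    forall i j : 'I_m.+1, (i <= j + n)%N -> `|S i j| <= K.
  have [K K0 KP] := bounds m.+1; exists K, (t *+ 4)^-1; split=> //.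
    by rewrite invr_gt0 mulrn_wgt0.
  move=> c w ce S S2 i j; apply: (KP c w) => //.
  by rewrite (leq_trans (ltnW (ltn_ord i))) ?leq_addl.
have cT c i : `|c| <= (t *+ 4)^-1 -> `|c * T i i| <= 4%:R^-1.
  move=> ce; rewrite normrM; apply: le_trans (_ : (t *+ 4)^-1 * t <= _).
    apply: ler_pM => //.
    by rewrite (le_trans (mxnorm_entry T i i)) // lerDr.
  by rewrite -mulr_natl invfM mulfVK ?gt_eqF.
have setup c w : `|c| <= (t *+ 4)^-1 ->
    let S := T * horner_mx T w in S * S = T + c *: (T * T) ->
  [/\ is_trig_mx S, S = S * e, forall i, `|S i i| <= B,
      forall i, (S i i) ^+ 2 = T i i + c * (T i i) ^+ 2 &
      forall i, S i i = T i i * w.[T i i]].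
  move=> ce S S2; have [trw diagw] := trigmx_horner w trT.
  have [trS diagS] := trigmxM trT trw.
  have dS i : S i i = T i i * w.[T i i] by rewrite /S diagS diagw.
  have dS2 i : (S i i) ^+ 2 = T i i + c * (T i i) ^+ 2.
    have [_ dSS] := trigmxM trS trS; have [_ dTT] := trigmxM trT trT.
    by rewrite expr2 -dSS S2 mxE [X in _ + X]mxE dTT expr2.
  split=> //.
    rewrite /S /e mulrA -(mulrA T _ T) -comT !mulrA {1}Tidx.
    by rewrite -!mulrA; congr (_ * (_ * _)); rewrite -!rmorphM mulrC.
  move=> i; rewrite -(@ler_pXn2r _ 2) ?nnegrE //.
  have leT : `|T i i| <= t by rewrite (le_trans (mxnorm_entry T i i)) // lerDr.
  rewrite -normrX dS2 (le_trans (ler_normD _ _)) // normrM normrX.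
  have le1 : `|c| * `|T i i| ^+ 2 <= t.
    rewrite expr2 mulrA -normrM -[t]mul1r ler_pM // (le_trans (cT c i ce)) //.
    by rewrite invf_le1 ?ler1n ?ltr0n.
  rewrite (le_trans (lerD leT le1)) // -mulr2n expr2 ler_peMl //.
  by rewrite (le_trans t1) // /B mulr2n lerDl ltW.
elim: n => [|n [K K0 KP]].
  exists B => // c w ce S S2 i j; rewrite addn0 leq_eqVlt.
  have [trS _ leB _ _] := setup c w ce S2.
  case/orP=> [/eqP/val_inj ->|/(is_trig_mxP trS) ->]; first exact: leB.
  by rewrite normr0.
pose t2 := mxnorm (T * T); pose ne := mxnorm e.
have t2_0 : 0 <= t2 := mxnorm_ge0 _.
have ne_0 : 0 <= ne := mxnorm_ge0 _.
(* [K1] bounds an entry obtained from Parlett's recurrence, and [K2] below one obtained from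
   [S = S e]. *)
pose K1 := Kap * (t + t2 + K ^+ 2 *+ m.+1).
have K1_0 : 0 <= K1.
  apply: mulr_ge0 => //; apply: addr_ge0; last by rewrite mulrn_wge0 ?exprn_ge0.
  by apply: addr_ge0 => //; apply: ltW.
pose K2 := K * ne *+ m.+1.
have K2_0 : 0 <= K2 by rewrite mulrn_wge0 ?mulr_ge0.
exists (K + K1 + K2) => [|c w ce S S2 i j]; first by rewrite !addr_ge0.
rewrite addnS leq_eqVlt => /orP[/eqP def_i|le_ij]; last first.
  rewrite (le_trans (KP c w ce S2 i j le_ij)) // -addrA lerDl addr_ge0 //.
have := setup c w ce S2; rewrite -/S => -[trS Se leB dS2 dS].
have ltji : (j < i)%N by rewrite def_i ltnS leq_addr.
have le_c (k : 'I_m.+1) : (j < k)%N -> `|S i k| <= K.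
  move=> ltjk; apply: (KP c w ce S2); rewrite def_i -addSn leq_add2r //.
have le_r (k : 'I_m.+1) : (k < i)%N -> `|S k j| <= K.
  by rewrite def_i ltnS => lekj; apply: (KP c w ce S2).
(* In [(S e) i j] the terms with [k <= j] vanish, [e] being lower triangular with [e j j = 0]; the
   others involve entries [S i k] closer to the diagonal. *)
have [/andP[/eqP Ti0 /eqP Tj0]|nz] := boolP ((T i i == 0) && (T j j == 0)).
  apply: le_trans (_ : K2 <= _); last by rewrite lerDr addr_ge0.
  rewrite Se -mulmxE mxE (le_trans (ler_norm_sum _ _ _)) //.
  rewrite /K2 -[X in _ *+ X](card_ord m.+1) -sumr_const; apply: ler_sum => k _.
  have [lekj|ltjk] := leqP k j; last first.
    by rewrite normrM ler_pM // ?le_c // mxnorm_entry.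
  have -> : e k j = 0; last by rewrite mulr0 normr0 mulr_ge0.
  move: lekj; rewrite leq_eqVlt => /orP[/eqP/val_inj ->|/(is_trig_mxP tre) //].
  by rewrite diage Tj0 mul0r.
apply: le_trans (_ : K1 <= _); last by rewrite addrAC lerDr addr_ge0.
rewrite negb_and in nz.
(* Equal diagonal entries of [T] give equal ones of [S], since both come from the same polynomial:
   this is where one common branch matters. *)
have le1 := sqrt_sum_bound B0 (leB i) (leB j) (cT c i ce) (cT c j ce) (dS2 i)
  (dS2 j)
  (fun eqT => etrans (etrans (dS i) (congr1 (fun z => z * w.[z]) eqT)) (esym
    (dS j))) nz.
apply: le_trans (ler_peMl (normr_ge0 (S i j)) le1) _.
rewrite -[leLHS]mulrA -normrM; apply: ler_pM; rewrite ?normr_ge0 //; [exact: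
  kap0|exact: leKap|].
have neq_ij : j != i by rewrite -(inj_eq val_inj) /= neq_ltn ltji.
have rec : (S i i + S j j) * S i j = T i j + c * (T * T) i j
    - \sum_(k | (k != i) && (k != j)) S i k * S k j.
  have SSij : (S * S) i j = \sum_k S i k * S k j by rewrite -mulmxE mxE.
  have := congr1 (fun X : 'M_m.+1 => X i j) S2.
  rewrite SSij (bigD1 i) //= (bigD1 j) //= [RHS]mxE [X in _ = _ + X]mxE => <-.
  by ring.
rewrite rec (le_trans (ler_normB _ _)) // lerD //.
  rewrite (le_trans (ler_normD _ _)) // lerD //.
    by rewrite (le_trans (mxnorm_entry T i j)) // lerDr.
  rewrite normrM -[t2]mul1r ler_pM ?mxnorm_entry // (le_trans ce) //.
  rewrite invf_le1 ?mulrn_wgt0 // (le_trans t1) // -{1}[t]mulr1n ler_wpMn2l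
    ?ltW //.
rewrite (le_trans (ler_norm_sum _ _ _)) //.
apply: le_trans (_ : \sum_(k < m.+1) K ^+ 2 <= _); last first.
  by rewrite sumr_const card_ord.
rewrite [leRHS](bigID (fun k => (k != i) && (k != j))) /= -[leLHS]addr0 lerD //.
  apply: ler_sum => k /andP[neq_ki neq_kj]; rewrite normrM expr2.
  have [/(is_trig_mxP trS) ->|leki] := ltnP i k.
    by rewrite normr0 mul0r mulr_ge0.
  have [/(is_trig_mxP trS) ->|lejk] := ltnP k j.
    by rewrite normr0 mulr0 mulr_ge0.
  by apply: ler_pM; rewrite // ?le_c ?le_r // ltn_neqAle ?leki ?lejk andbT //
    eq_sym.
by apply: sumr_ge0 => k _; rewrite exprn_ge0.
Qed.

(** Schur triangularisation of [D] reduces to the triangular case; the change of basis depends on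
    [D] alone and costs a constant factor. *)
Lemma mx_sqrt_bounded (D : 'M[C]_m.+1) u : D = D * D * horner_mx D u ->
  exists K e0 : C, [/\ 0 <= K, 0 < e0 & forall c w, `|c| <= e0 ->
    let S := D * horner_mx D w in S * S = D + c *: (D * D) -> mxnorm S <= K].
Proof.
move=> Didx; have [P Pu] := Schur D (ltn0Sn m).
rewrite /similar_to conjumx ?unitarymx_unit // => trT.
have uP := unitarymx_unit Pu; have Pr : P \is a GRing.unit by [].
pose T := P *m D *m invmx P.
have conjP (X Y : 'M_m.+1) :
    (P *m X *m invmx P) * (P *m Y *m invmx P) = P *m (X * Y) *m invmx P.
  by rewrite -!mulmxE !mulmxA mulmxKV.
have conjT p : T * horner_mx T p = P *m (D * horner_mx D p) *m invmx P.
  by rewrite /T horner_mx_uconj // conjP.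
have TT : T * T = P *m (D * D) *m invmx P by rewrite conjP.
have Tidx : T = T * T * horner_mx T u.
  by rewrite TT /T horner_mx_uconj // conjP -Didx.
have [K [e0 [K0 e0_gt0 KP]]] := trigmx_sqrt_bounded trT Tidx.
exists (mxnorm (invmx P) * (K *+ m.+1 *+ m.+1) * mxnorm P), e0; split=> //.
  by rewrite !mulr_ge0 ?mxnorm_ge0 ?mulrn_wge0.
move=> c w ce S2; pose S := D * horner_mx D w.
have S_T : S = invmx P *m (T * horner_mx T w) *m P.
  by rewrite conjT !mulmxA mulVmx // mul1mx mulmxKV.
have -> : D * horner_mx D w = invmx P *m (T * horner_mx T w) *m P by [].
apply: le_trans (mxnormM _ _) _; apply: ler_wpM2r; first exact: mxnorm_ge0.
apply: le_trans (mxnormM _ _) _; apply: ler_wpM2l; first exact: mxnorm_ge0.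
apply: mxnorm_le; apply: (KP c w ce).
by rewrite conjT conjP -/S S2 TT mulmxDr mulmxDl -scalemxAr -scalemxAl.
Qed.
End TriangularSquareRoot.

(** * Modes *)

Section Mode.
Variables (C : numClosedFieldType) (m : nat).
Variables (D Pi Z0 Z1 MG : 'M[C]_m.+1) (w u : {poly C}) (rho : C).
Local Notation hD := (horner_mx D).
Let F : 'M[C]_m.+1 := 1%:M + (rho / 4%:R) *: D.
Let L : 'M[C]_m.+1 := 1%:M + (rho / 2%:R) *: D.
Let S : 'M[C]_m.+1 := D * hD w.

Hypotheses (DPi : D * Pi = D) (PiD : Pi * D = D) (PiPi : Pi * Pi = Pi).
Hypotheses (rho0 : rho != 0) (Fu : F \in unitmx) (S2 : S * S = rho *: (D * F)).
Hypotheses (Didx : D = D * D * hD u).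
Hypotheses (Z0E : Z0 = (L + S) * Pi) (Z1E : Z1 = (L - S) * Pi).
Hypothesis MGinv : group_inverse ((Z1 - Z0) *m Pi) MG.

(** With [L] and [S] written as values at [D] of polynomials, identities for the modes are checked
    in the commutative ring of polynomials. *)
Let l : {poly C} := 1 + (rho / 2%:R)%:P * 'X.
Let s : {poly C} := 'X * w.

Let hl : hD l = L. Proof. exact: horner_mx_affine. Qed.
Let hs : hD s = S. Proof. by rewrite rmorphM /= horner_mx_X. Qed.

Lemma comm_proj_horner p : Pi * hD p = hD p * Pi.
Proof. by apply: comm_mx_horner; rewrite /comm_mx !mulmxE PiD DPi. Qed.

Lemma Z_diffE : (Z1 - Z0) *m Pi = - 2%:R *: S.
Proof.
rewrite mulmxE Z1E Z0E -mulrBl -mulrA PiPi opprD addrACA subrr add0r -opprD.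
rewrite mulNr mulrDl scaleNr scaler_nat mulr2n; congr (- (_ + _));
by rewrite -hs -comm_proj_horner hs /S mulrA PiD.
Qed.

Lemma MG_poly : exists g, MG = hD g.
Proof.
have [q ->] := group_inverse_poly MGinv.
by exists (q \Po (- 2%:R *: s)); rewrite Z_diffE -hs -linearZ horner_mx_comp.
Qed.

(** Both sides are polynomials in [D] that have [D] as a factor and fix [D], hence they agree. The
    left side fixes [S], so also [S^2 = rho D F], and then [D] as [F] is invertible. *)
Lemma MG_mul_S : - 2%:R *: (MG * S) = D * hD u.
Proof.
have [g def_MG] := MG_poly; have [MXM XMX MX] := MGinv.
rewrite Z_diffE in MXM XMX MX; set e := _ *: _.
have eE : e = MG * (- 2%:R *: S) by rewrite -scalerAr.
have SE : e * S = S.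
  have n2 : - 2%:R != 0 :> C by rewrite oppr_eq0 pnatr_eq0.
  by apply: (scalerI n2); rewrite eE scalerAr -MX MXM.
have eD : e * D = D.
  have Fr : F \is a GRing.unit by [].
  apply: (mulIr Fr); apply: (scalerI rho0).
  by rewrite -mulrA scalerAr -S2 mulrA SE.
have def_e : e = D * hD (- 2%:R *: (g * w)).
  rewrite eE def_MG linearZ /= rmorphM /= -!scalerAr /S; congr (_ *: _).
  have comD : D * hD g = hD g * D by apply: comm_mx_horner.
  by rewrite !mulrA comD.
transitivity (e * (D * hD u)); last by rewrite mulrA eD.
have comD p : D * hD p = hD p * D by apply: comm_mx_horner.
have com_u p : hD u * hD p = hD p * hD u by rewrite -!rmorphM mulrC.
rewrite {1}def_e {1}Didx -mulrA com_u def_e.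
by rewrite mulrA -[D * D * _]mulrA [in LHS]comD !mulrA.
Qed.

Lemma Z0_expE j : Z0 ^+ j * Pi = (L + S) ^+ j * Pi.
Proof.
have comPi : Pi * (L + S) = (L + S) * Pi.
  by rewrite -hl -hs -rmorphD comm_proj_horner.
elim: j => // j IHj; rewrite !exprSr -!mulrA {2}Z0E -[(L + S) * Pi * Pi]mulrA.
by rewrite PiPi -comPi mulrA IHj -mulrA.
Qed.

Lemma Z1_expE j : Z1 ^+ j * Pi = (L - S) ^+ j * Pi.
Proof.
have comPi : Pi * (L - S) = (L - S) * Pi.
  by rewrite -hl -hs -rmorphB comm_proj_horner.
elim: j => // j IHj; rewrite !exprSr -!mulrA {2}Z1E -[(L - S) * Pi * Pi]mulrA.
by rewrite PiPi -comPi mulrA IHj -mulrA.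
Qed.

Section ModeVectors.
Variables (k : C) (x y : 'cV[C]_m.+1).
Hypotheses (Pix : Pi *m x = x) (Piy : Pi *m y = y).

Definition mode_vec j : 'cV[C]_m.+1 :=
  Z0 ^+ j *m Pi *m (MG *m ((Z1 - 1%:M) *m x - k *: y))
  + Z1 ^+ j *m Pi *m (MG *m (k *: y - (Z0 - 1%:M) *m x)).

(** On vectors fixed by [Pi] the projections disappear, and only polynomials in [D] act on [x] and
    [y]. *)
Lemma mode_vecE : exists2 g, MG = hD g & forall j, mode_vec j =
  hD ((l + s) ^+ j * g * (l - s - 1) - (l - s) ^+ j * g * (l + s - 1)) *m x
  + hD (k *: ((l - s) ^+ j * g - (l + s) ^+ j * g)) *m y.
Proof.
have [g def_MG] := MG_poly; exists g => // j.
have absorb p z : Pi *m z = z -> Pi *m (hD p *m z) = hD p *m z.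
  by move=> Piz; rewrite mulmxA mulmxE comm_proj_horner -mulmxE -mulmxA Piz.
have h1 : hD 1 = 1%:M := rmorph1 _.
have Z1x : (Z1 - 1%:M) *m x = hD (l - s - 1) *m x.
  have Z1x : Z1 *m x = (L - S) *m x by rewrite {1}Z1E -mulmxE -mulmxA Pix.
  by rewrite mulmxBl Z1x -mulmxBl !rmorphB /= h1 hl hs.
have Z0x : (Z0 - 1%:M) *m x = hD (l + s - 1) *m x.
  have Z0x : Z0 *m x = (L + S) *m x by rewrite {1}Z0E -mulmxE -mulmxA Pix.
  by rewrite mulmxBl Z0x -mulmxBl rmorphB rmorphD /= h1 hl hs.
rewrite /mode_vec Z1x Z0x def_MG !mulmxE Z0_expE Z1_expE -!mulmxE -!mulmxA.
rewrite -hl -hs -!rmorphB -!rmorphD -!rmorphXn.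
have absorb2 p a : Pi *m (hD g *m (hD p *m x + a *: y)) = 
   hD g *m (hD p *m x + a *: y).
  by rewrite absorb // mulmxDr absorb // -scalemxAr Piy.
have -> : k *: y - hD (l + s - 1) *m x = hD (- (l + s - 1)) *m x + k *: y.
  by rewrite raddfN /= mulNmx addrC.
rewrite -scaleNr !absorb2 !mulmxDr -!scalemxAr !mulmxA !mulmxE -!rmorphM /=.
rewrite addrACA -mulmxDl -rmorphD /= mulrN.
rewrite scaleNr addrC [X in X + _ = _]addrC -scalerBr -mulmxBl -rmorphB /=
  scalemxAl.
by rewrite -linearZ /= addrC.
Qed.

Lemma mode_vec_recurrence j :
  mode_vec j.+2 + mode_vec j = 2%:R *: mode_vec j.+1 + rho *: (D *m mode_vec
    j.+1).
Proof.
have [g _ WE] := mode_vecE; apply/eqP; rewrite -subr_eq0 !WE.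
(* The characteristic polynomial [z^2 - 2 l z + 1] takes the value [s^2 - l^2 + 1] at both [l + s]
   and [l - s]; it vanishes at [D] because [S^2 = rho D F]. *)
have char_eq p : hD (p * (s ^+ 2 - l ^+ 2 + 1)) = 0.
  have -> : s ^+ 2 - l ^+ 2 + 1 = s * s - rho *: ('X * (1 + (rho / 4%:R)%:P *
    'X)).
    rewrite -mul_polyC /l.
    have -> : rho / 2%:R = rho / 4%:R *+ 2 by field.
    have {2}-> : rho = rho / 4%:R *+ 4 by field.
    by rewrite !raddfMn /=; ring.
  rewrite rmorphM /= rmorphB /= linearZ /=.
  have -> : hD ('X * (1 + (rho / 4%:R)%:P * 'X)) = D * F.
    by rewrite rmorphM /= horner_mx_X horner_mx_affine.
  have -> : hD (s * s) = S * S by rewrite rmorphM /= hs.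
  by rewrite S2 subrr mulr0.
have two_l (z : 'cV[C]_m.+1) :
    2%:R *: z + rho *: (D *m z) = hD (l *+ 2) *m z.
  have -> : hD (l *+ 2) = 2%:R *: L by rewrite raddfMn /= hl scaler_nat.
  rewrite -scalemxAl /L mulmxDl mul1mx scalerDr -scalemxAl scalerA.
  by rewrite mulrC divfK ?pnatr_eq0.
rewrite two_l mulmxDr !mulmxA !mulmxE -!rmorphM addrACA -!mulmxDl -!rmorphD.
rewrite opprD addrACA -!mulmxBl -!rmorphB !exprS.
rewrite (_ : _ - _ = ((l + s) ^+ j * g * (l - s - 1)
    - (l - s) ^+ j * g * (l + s - 1)) * (s ^+ 2 - l ^+ 2 + 1)); last by ring.
rewrite (_ : k *: _ + _ - _ = k *: (((l - s) ^+ j * g - (l + s) ^+ j * g)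
    * (s ^+ 2 - l ^+ 2 + 1))); last by rewrite -!mul_polyC; ring.
rewrite /=.
by rewrite linearZ /= !char_eq scaler0 !mul0mx addr0.
Qed.

(** The coefficient of [x] collapses to [-2 g s], which at [D] is the projection onto the range of
    [D]. *)
Lemma mode_vec0 : mode_vec 0 = D *m hD u *m x.
Proof.
have [g def_MG WE] := mode_vecE; rewrite WE !expr0 !mul1r subrr scaler0 raddf0
  mul0mx addr0.
rewrite -mulrBr (_ : _ - _ = - 2%:R *: s); last first.
  by rewrite -mul_polyC raddfN /= polyC_natr; ring.
by rewrite -scalerAr /= linearZ /= rmorphM /= -def_MG hs MG_mul_S.
Qed.

(** The terms in [x] cancel because [l + s - 1] and [l - s - 1] commute; those in [y] leave
    [-2 k g s]. *)
Lemma mode_vec1 : mode_vec 1 - mode_vec 0 = k *: (D *m hD u *m y).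
Proof.
have [g def_MG WE] := mode_vecE; rewrite !WE !expr0 !expr1 !mul1r opprD addrACA.
rewrite -!mulmxBl -!rmorphB (_ : _ - _ = 0); last by ring.
rewrite raddf0 mul0mx add0r subrr scaler0 subr0 /= linearZ /= -scalemxAl; congr
  (_ *: (_ *m _)).
rewrite -mulrBl (_ : _ - _ = - 2%:R *: s); last first.
  by rewrite -mul_polyC raddfN /= polyC_natr; ring.
by rewrite -scalerAl /= linearZ /= mulrC rmorphM /= -def_MG hs MG_mul_S.
Qed.

Lemma proj_mode_vec j : Pi *m mode_vec j = mode_vec j.
Proof.
have [g _ WE] := mode_vecE; rewrite WE mulmxDr !mulmxA !mulmxE
  !comm_proj_horner.
by rewrite -!mulmxE -!mulmxA Pix Piy.
Qed.

(** A vector killed by [Q] is fixed by [1 - Q' Q], so its image under [D] is killed too: the kernel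
    of [Q] is stable under every polynomial in [D]. *)
Lemma mode_vec_ker (p : nat) (Q : 'M[C]_(p, m.+1)) (Q' : 'M[C]_(m.+1, p)) j :
  Q *m D *m (1%:M - Q' *m Q) = 0 -> Q *m x = 0 -> Q *m y = 0 -> Q *m mode_vec j
    = 0.
Proof.
move=> QD Qx Qy; have [g _ ->] := mode_vecE.
have QDz (z : 'cV[C]_m.+1) : Q *m z = 0 -> Q *m (D *m z) = 0.
  move=> Qz; have := congr1 (mulmx^~ z) QD.
  by rewrite -mulmxA mulmxBl mul1mx -[Q' *m Q *m z]mulmxA Qz mulmx0 subr0
    mul0mx -mulmxA.
have QhDz q (z : 'cV[C]_m.+1) : Q *m z = 0 -> Q *m (hD q *m z) = 0.
  move=> Qz; elim/poly_ind: q => [|q c IHq]; first by rewrite raddf0 mul0mx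
    mulmx0.
  rewrite rmorphD /= horner_mx_C mulrC rmorphM /= horner_mx_X mulmxDl mulmxDr
    mul_scalar_mx.
  by rewrite -scalemxAr Qz scaler0 addr0 -mulmxE -mulmxA QDz.
by rewrite mulmxDr !QhDz // addr0.
Qed.

End ModeVectors.
End Mode.

(** * Small time steps *)

Section Asymptotics.
Variables (R : realType) (m : nat).
Local Notation C := R[i].
Implicit Types (D S M Y : 'M[C]_m.+1) (u w : {poly C}).

Lemma ge0_complexE (x : C) : 0 <= x -> x = (complex.Re x)%:C.
Proof. by case: x => a b; rewrite lecE /= => /andP[/eqP -> _]. Qed.

Lemma mxnorm_expr_le Y j :
  mxnorm ((1 + Y) ^+ j) <= mxnorm (1 : 'M[C]_m.+1) * (1 + mxnorm Y) ^+ j.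
Proof.
elim: j => [|j IHj]; first by rewrite !expr0 mulr1.
rewrite exprSr mulrDr mulr1; apply: le_trans (mxnormD _ _) _.
apply: le_trans (_ : mxnorm ((1 + Y) ^+ j) * (1 + mxnorm Y) <= _).
  by rewrite mulrDr mulr1 lerD2l; apply: mxnormM.
by rewrite exprSr mulrA ler_wpM2r // addr_ge0 ?mxnorm_ge0.
Qed.

Lemma exprn_expR_le (a : R) j : 0 <= a -> (1 + a) ^+ j <= expR (a * j%:R).
Proof.
move=> a0; rewrite mulrC expRM_natl; apply: lerXn2r; rewrite ?nnegrE ?expR_ge0
  ?addr_ge0 //.
exact: expR_ge1Dx.
Qed.

(** As [Y] inverts [F] and [G] inverts [D] on its range, [S (S G Y) = D F G Y = D G], a projection
    that fixes [S]. *)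
Lemma sqrt_group_inverse D F G S Y (c : C) : c != 0 ->
    S * S = D * F -> F * Y = 1 -> S * G = G * S -> F * G = G * F ->
    Y * S = S * Y -> D * G * S = S ->
  group_inverse (c *: S) (c^-1 *: (S * G * Y)).
Proof.
move=> c0 S2 FY SG FG YS eS.
have S1Z : S * (S * G * Y) = D * G.
  by rewrite !mulrA S2 -[D * F * G]mulrA FG mulrA -mulrA FY mulr1.
have ZS1 : S * G * Y * S = D * G.
  by rewrite -S1Z -mulrA YS !mulrA -[S * G * S]mulrA -SG !mulrA.
have SV : (c *: S) * (c^-1 *: (S * G * Y)) = D * G.
  by rewrite -scalerAl -scalerAr scalerA mulfV // scale1r.
have VS : (c^-1 *: (S * G * Y)) * (c *: S) = D * G.
  by rewrite -scalerAl -scalerAr scalerA mulVf // scale1r.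
by split; rewrite ?SV ?VS // -scalerAr ?eS // !mulrA eS.
Qed.

(** [S] is of order [k] and its group inverse of order [1/k], with constants independent of [k] and
    of [w], hence of the branch chosen. *)
Lemma mode_asymptotics D u (theta : C) (T : R) :
    D = D * D * horner_mx D u -> theta != 0 ->
  exists (K : C) (k0 : R), 0 < k0 /\ forall (k : R) w (MG : 'M[C]_m.+1),
    0 < k <= k0 ->
    let rho := (k%:C * theta) ^+ 2 in
    let F := 1%:M + (rho / 4%:R) *: D in
    let S := D * horner_mx D w in
    F \in unitmx -> S * S = rho *: (D * F) ->
    (forall j, k * j%:R <= T ->
       mxnorm ((1%:M + (rho / 2%:R) *: D + S) ^+ j) <= K) /\
    (group_inverse (- 2%:R *: S) MG -> mxnorm (k%:C *: MG) <= K).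
Proof.
move=> Didx theta0.
have [K1 [e0 [K1_ge0 e0_gt0 K1P]]] := mx_sqrt_bounded Didx.
pose nD := mxnorm D; pose n1 := mxnorm (1 : 'M[C]_m.+1); pose q := `|theta| ^+
  2.
have nD0 : 0 <= nD := mxnorm_ge0 D.
have n10 : 0 <= n1 := mxnorm_ge0 1.
have q0 : 0 <= q by rewrite exprn_ge0.
(* The condition [k X <= 1] ensures at once [k <= 1], [|rho / 4| <= e0] for the bound on the square
   root, and [|rho / 4| nD <= 1/2] for the inverse of [F]. *)
pose X := 1 + q / e0 + q * nD * 2%:R.
have qe0 : 0 <= q / e0 by rewrite divr_ge0 // ltW.
have qnD0 : 0 <= q * nD * 2%:R by rewrite !mulr_ge0.
have X1 : 1 <= X by rewrite /X -addrA lerDl addr_ge0.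
have Xpos : 0 < X := lt_le_trans ltr01 X1.
pose x := complex.Re X; have XE : X = x%:C := ge0_complexE (ltW Xpos).
have x0 : 0 < x by rewrite -ltcR -XE.
pose Kc := q * nD + `|theta| * K1.
have Kc0 : 0 <= Kc by rewrite addr_ge0 ?mulr_ge0.
pose kc := complex.Re Kc; have KcE : Kc = kc%:C := ge0_complexE Kc0.
have kc0 : 0 <= kc by rewrite -lecR -KcE.
(* The group inverse of [D]. *)
pose Dg := D * horner_mx D (u * u).
pose Ka := n1 * (expR (kc * T))%:C.
have Ka0 : 0 <= Ka by rewrite mulr_ge0 // lecR expR_ge0.
pose Kb := `|theta|^-1 * (K1 * mxnorm Dg * (n1 *+ 2)).
have Kb0 : 0 <= Kb by rewrite !mulr_ge0 ?invr_ge0 ?mxnorm_ge0 ?mulrn_wge0.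
exists (Ka + Kb), x^-1; split; first by rewrite invr_gt0.
move=> k w MG /andP[k_gt0 le_k] rho F S Fu S2.
have kX : k%:C * X <= 1.
  by rewrite XE -rmorphM lecR -ler_pdivlMr // div1r.
have kC0 : 0 <= k%:C by rewrite lecR ltW.
have k1 : k%:C <= 1 by rewrite (le_trans _ kX) // ler_peMr.
have kCn0 : k%:C != 0 by rewrite gt_eqF // ltcR.
have rho_le : `|rho| <= k%:C * q.
  rewrite /rho normrX normrM ger0_norm // exprMn -/q ler_wpM2r //.
  by rewrite expr2 ler_piMl.
have rho4_le : `|rho / 4%:R| <= `|rho|.
  by rewrite normrM normfV normr_nat ler_piMr // invf_le1 ?ler1n ?ltr0n.
have kq_le : k%:C * q <= e0.
  rewrite -[leRHS]mul1r -ler_pdivrMr // -mulrA (le_trans _ kX) // ler_wpM2l //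
    /X -addrA addrCA lerDl.
  by rewrite addr_ge0.
have kqD_le : k%:C * q * nD * 2%:R <= 1.
  rewrite -2!mulrA (le_trans _ kX) // ler_wpM2l // /X -[q * nD * 2%:R]mulrA
    lerDr.
  by rewrite addr_ge0.
pose tau := k%:C * theta.
have tau0 : tau != 0 by rewrite mulf_neq0.
pose S1 := D * horner_mx D (tau^-1 *: w).
have SE : S = tau *: S1.
  by rewrite /S1 linearZ /= -scalerAr scalerA mulfV // scale1r.
have S12 : S1 * S1 = D * F.
  have t20 : tau ^+ 2 != 0 by rewrite expf_neq0.
  by apply: (scalerI t20); rewrite -S2 SE -scalerAl -scalerAr scalerA expr2.
have nS1 : mxnorm S1 <= K1.
  apply: (K1P (rho / 4%:R)); first by rewrite (le_trans rho4_le) // (le_trans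
    rho_le).
  by rewrite -/S1 S12 mulrDr -scalerAr mulr1.
split.
  move=> j kjT.
  apply: le_trans (_ : Ka <= _); last by rewrite lerDl.
  rewrite -addrA; apply: le_trans (mxnorm_expr_le _ _) _.
  rewrite ler_wpM2l //.
  apply: le_trans (_ : (1 + k%:C * Kc) ^+ j <= _).
    apply: lerXn2r; rewrite ?nnegrE ?addr_ge0 ?mxnorm_ge0 ?mulr_ge0 // lerD2l.
    apply: le_trans (mxnormD _ _) _; rewrite SE !mxnormZ /Kc mulrDr lerD //.
      rewrite -/nD mulrA ler_wpM2r // (le_trans _ rho_le) //.
      by rewrite normrM normfV normr_nat ler_piMr // invf_le1 ?ler1n ?ltr0n.
    rewrite normrM ger0_norm // -mulrA ler_wpM2l // ler_wpM2l //.
  rewrite KcE -rmorphM -(rmorph1 (real_complex R)) -rmorphD -rmorphXn lecR.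
  apply: le_trans (exprn_expR_le _ _) _; first by rewrite mulr_ge0 // ltW.
  by rewrite ler_expR mulrAC mulrC ler_wpM2l.
move=> MGinv.
pose Y := invmx F.
have FY : F * Y = 1 by exact: mulmxV.
have YF : Y * F = 1 by exact: mulVmx.
have nY : mxnorm Y <= n1 *+ 2.
  (* The perturbation term has at most half the norm of [Y], so [Y] has at most twice the norm of
     the identity. *)
  have YE : Y = 1 + (- (rho / 4%:R)) *: (D * Y).
    by apply/eqP; rewrite scaleNr eq_sym subr_eq -[X in X == _]FY mulrDl mul1r
      -scalerAl.
  have : mxnorm Y <= n1 + mxnorm Y / 2%:R.
    rewrite {1}YE (le_trans (mxnormD _ _)) // lerD2l mxnormZ normrN.
    apply: le_trans (_ : k%:C * q * (nD * mxnorm Y) <= _).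
      by rewrite ler_pM ?mxnorm_ge0 ?(le_trans rho4_le) // mxnormM.
    rewrite mulrA mulrC ler_wpM2l ?mxnorm_ge0 //.
    by rewrite -[leRHS]mul1r ler_pdivlMr ?ltr0n.
  rewrite -lerBlDr {1}(splitr (mxnorm Y)) addrK.
  by rewrite ler_pdivrMr ?ltr0n // mulr_natr.
have MGE : MG = (- 2%:R * tau)^-1 *: (S1 * Dg * Y).
  pose hD := horner_mx D.
  have comP p r : hD p * hD r = hD r * hD p by rewrite /hD -!rmorphM mulrC.
  have S1E : S1 = hD ('X * (tau^-1 *: w)) by rewrite /hD rmorphM /= horner_mx_X.
  have DgE : Dg = hD ('X * (u * u)) by rewrite /hD rmorphM /= horner_mx_X.
  have FE : F = hD (1 + (rho / 4%:R)%:P * 'X) by rewrite /hD horner_mx_affine.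
  have comS1Dg : S1 * Dg = Dg * S1 by rewrite S1E DgE comP.
  have comFDg : F * Dg = Dg * F by rewrite FE DgE comP.
  have comFS1 : F * S1 = S1 * F by rewrite FE S1E comP.
  have invcom (V : 'M[C]_m.+1) : F * V = V * F -> Y * V = V * Y.
    by move=> FV; rewrite -[V in LHS]mulr1 -FY !mulrA -[Y * V * F]mulrA -FV
      mulrA YF mul1r.
  have comYS1 := invcom _ comFS1.
  have ME : - 2%:R *: S = (- 2%:R * tau) *: S1 by rewrite SE scalerA.
  have t2 : - 2%:R * tau != 0 by rewrite mulf_neq0 // oppr_eq0 pnatr_eq0.
  apply: group_inverse_uniq MGinv _; rewrite ME.
  apply: (sqrt_group_inverse t2 S12 FY comS1Dg comFDg comYS1).
  have comD p : hD p * D = D * hD p by apply/esym; apply: comm_mx_horner.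
  rewrite /Dg /S1 (rmorphM _ u) /= !mulrA -Didx -[D * _ * D]mulrA comD.
  by rewrite mulrA -Didx.
rewrite MGE scalerA mxnormZ; apply: le_trans (_ : Kb <= _); last by rewrite
  lerDr.
apply: ler_pM; rewrite ?mxnorm_ge0 //.
  have -> : k%:C * (- 2%:R * tau)^-1 = - (2%:R^-1 * theta^-1).
    rewrite /tau; field; by rewrite theta0 kCn0.
  rewrite normrN normrM normfV normr_nat normfV ler_piMl ?invr_ge0 //.
  by rewrite invf_le1 ?ler1n ?ltr0n.
apply: le_trans (mxnormM _ _) _; apply: ler_pM; rewrite ?mxnorm_ge0 //.
by apply: le_trans (mxnormM _ _) _; apply: ler_pM; rewrite ?mxnorm_ge0.
Qed.
End Asymptotics.

(** * Uniform bounds for the time factors *)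

Section BoundedModes.
Variables (R : realType) (m : nat).
Local Notation C := R[i].

(** The growth of [MG] like [1/k] is compensated: [(Z1 - 1) x - k y = k z - S x] with [z] bounded,
    and [MG S x = - D u(D) x / 2] does not depend on [k]. The same holds for [Z0], with [-z]. *)
Lemma mode_vec_bounded (D Pi : 'M[C]_m.+1) u (theta : C) (T : R) (x y :
  'cV[C]_m.+1) :
    D = D * D * horner_mx D u -> theta != 0 ->
    D * Pi = D -> Pi * D = D -> Pi * Pi = Pi -> Pi *m x = x ->
  exists (K : C) (k0 : R), 0 < k0 /\
  forall (k : R) w (Z0 Z1 MG : 'M[C]_m.+1) j, 0 < k <= k0 -> k * j%:R <= T ->
    let rho := (k%:C * theta) ^+ 2 in
    let L := 1%:M + (rho / 2%:R) *: D in
    let F := 1%:M + (rho / 4%:R) *: D in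
    let S := D * horner_mx D w in
    F \in unitmx -> S * S = rho *: (D * F) ->
    Z0 = (L + S) * Pi -> Z1 = (L - S) * Pi ->
    group_inverse ((Z1 - Z0) *m Pi) MG ->
  mxnorm (mode_vec Pi Z0 Z1 MG k%:C x y j) <= K.
Proof.
move=> Didx theta0 DPi PiD PiPi Pix.
have [K [k0 [k0_gt0 KP]]] := mode_asymptotics T Didx theta0.
pose c0 := k0%:C * `|theta| ^+ 2.
pose K1 := K * (c0 * mxnorm (D *m x) + mxnorm y) +
  mxnorm (2%:R^-1 *: (D * horner_mx D u) *m x).
exists (K * mxnorm Pi * K1 + K * mxnorm Pi * K1), k0; split=> //.
move=> k w Z0 Z1 MG j /andP[k_gt0 le_k] kjT rho L F S Fu S2 Z0E Z1E MGinv.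
have bnds : 0 < k <= k0 by rewrite k_gt0.
have kCn0 : k%:C != 0 by rewrite gt_eqF // ltcR.
have rho0 : rho != 0 by rewrite expf_neq0 ?mulf_neq0.
have ME := Z_diffE DPi PiD PiPi Z0E Z1E.
have MGS := MG_mul_S DPi PiD PiPi rho0 Fu S2 Didx Z0E Z1E MGinv.
have [powK MGK] := KP k w MG bnds Fu S2.
have {}MGK : mxnorm (k%:C *: MG) <= K by apply: MGK; rewrite -ME.
(* The estimate is uniform in [w], so [-w] handles the powers of [L - S]. *)
have SN : D * horner_mx D (- w) = - S by rewrite rmorphN /= mulrN.
have powN i : k * i%:R <= T -> mxnorm ((L - S) ^+ i) <= K.
  have S2N : D * horner_mx D (- w) * (D * horner_mx D (- w)) = rho *: (D * F).
    by rewrite SN mulrNN.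
  by have [+ _] := KP k (- w) MG bnds Fu S2N; rewrite SN; apply.
have MGSx : MG *m (S *m x) = - (2%:R^-1 *: (D * horner_mx D u) *m x).
  rewrite -MGS scalerA mulrN mulVf ?pnatr_eq0 // scaleN1r mulNmx opprK.
  by rewrite -mulmxE -!mulmxA.
pose z := (k%:C * theta ^+ 2 / 2%:R) *: (D *m x) - y.
have rhoE : rho / 2%:R = k%:C * (k%:C * theta ^+ 2 / 2%:R).
  by rewrite /rho; field.
have nz : mxnorm z <= c0 * mxnorm (D *m x) + mxnorm y.
  rewrite /z -scaleN1r; apply: le_trans (mxnormD _ _) _.
  rewrite !mxnormZ normrN normr1 mul1r lerD2r ler_wpM2r ?mxnorm_ge0 //.
  have kC0 : 0 <= k%:C by rewrite lecR ltW.
  rewrite normrM normfV normr_nat normrM normrX (ger0_norm kC0) /c0.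
  apply: le_trans (_ : k%:C * `|theta| ^+ 2 <= _).
    by rewrite ler_piMr ?mulr_ge0 ?exprn_ge0 // invf_le1 ?ler1n ?ltr0n.
  by rewrite ler_wpM2r ?exprn_ge0 // lecR.
have z1 : MG *m ((Z1 - 1%:M) *m x - k%:C *: y) = (k%:C *: MG) *m z - MG *m (S
  *m x).
  have -> : (Z1 - 1%:M) *m x = (rho / 2%:R) *: (D *m x) - S *m x.
    rewrite mulmxBl Z1E -mulmxE -mulmxA Pix mulmxBl /L mulmxDl mul1mx
      -scalemxAl.
    by rewrite [x + _]addrC addrAC addrK.
  rewrite /z -scalemxAl [k%:C *: (MG *m _)]scalemxAr scalerBr scalerA -rhoE
    -mulmxBr.
  by rewrite addrAC.
have z2 : MG *m (k%:C *: y - (Z0 - 1%:M) *m x) = (k%:C *: MG) *m (- z) - MG *m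
  (S *m x).
  have -> : (Z0 - 1%:M) *m x = (rho / 2%:R) *: (D *m x) + S *m x.
    rewrite mulmxBl Z0E -mulmxE -mulmxA Pix mulmxDl /L mulmxDl mul1mx
      -scalemxAl.
    by rewrite [x + _]addrC addrAC addrK.
  rewrite /z -scalemxAl [k%:C *: (MG *m _)]scalemxAr scalerN scalerBr scalerA
    -rhoE -mulmxBr.
  by rewrite opprD opprB addrA.
have nMG (z' : 'cV[C]_m.+1) : mxnorm z' <= c0 * mxnorm (D *m x) + mxnorm y ->
    mxnorm ((k%:C *: MG) *m z' - MG *m (S *m x)) <= K1.
  move=> nz'; rewrite MGSx opprK; apply: le_trans (mxnormD _ _) _.
  rewrite lerD2r; apply: le_trans (mxnormM _ _) _.
  by apply: ler_pM; rewrite ?mxnorm_ge0.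
have nNz : mxnorm (- z) <= c0 * mxnorm (D *m x) + mxnorm y.
  by rewrite -scaleN1r mxnormZ normrN normr1 mul1r.
have bnd (X : 'M[C]_m.+1) (z' : 'cV[C]_m.+1) : mxnorm X <= K -> mxnorm z' <= K1
  ->
    mxnorm (X * Pi *m z') <= K * mxnorm Pi * K1.
  move=> nX nz'; apply: le_trans (mxnormM _ _) _.
  apply: ler_pM; rewrite ?mxnorm_ge0 //.
  by apply: le_trans (mxnormM _ _) _; rewrite ler_wpM2r ?mxnorm_ge0.
rewrite /mode_vec; apply: le_trans (mxnormD _ _) _.
rewrite !mulmxE (Z0_expE DPi PiD PiPi Z0E) (Z1_expE DPi PiD PiPi Z1E) z1 z2.
apply: lerD; apply: bnd; [exact: powK|exact: nMG|exact: powN|].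
by apply: nMG; exact: nNz.
Qed.
End BoundedModes.

(** * The discrete Sturm-Liouville expansion *)

Section SturmLiouville.
Variables (R : realType) (m N : nat) (alpha beta : R).
Variables (lam : nat -> R) (v : nat -> nat -> R).
Hypotheses (N2 : (2 <= N)%N).
Hypotheses (alphaN : 1 - alpha * N%:R != 0) (betaN : 1 + beta * N%:R != 0).
Hypothesis SL : SL_eigensystem N alpha beta lam v.

Definition sqnorm l : R := \sum_(1 <= i < N) v l i ^+ 2.

Definition SL_coef l (W : nat -> 'cV[R[i]]_m.+1) : 'cV[R[i]]_m.+1 :=
  (sqnorm l)%:C^-1 *: \sum_(1 <= i < N) (v l i)%:C *: W i.

Lemma coefP_SL_coef k (Z1 MG : 'M[R[i]]_m.+1) F G l :
  coefP N k Z1 MG F G (v l) =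
  MG *m ((Z1 - 1%:M) *m SL_coef l F - k%:C *: SL_coef l G).
Proof.
rewrite /coefP /SL_coef -/(sqnorm l); congr (_ *m _).
rewrite -scalemxAr [k%:C *: _]scalerA mulrC -scalerA -scalerBr; congr (_ *: _).
rewrite mulmx_sumr scaler_sumr -sumrB; apply: eq_bigr => s _.
by rewrite scalerBr scalemxAr scalerA mulrC -scalerA.
Qed.

Lemma coefQ_SL_coef k (Z0 MG : 'M[R[i]]_m.+1) F G l :
  coefQ N k Z0 MG F G (v l) =
  MG *m (k%:C *: SL_coef l G - (Z0 - 1%:M) *m SL_coef l F).
Proof.
rewrite /coefQ /SL_coef -/(sqnorm l); congr (_ *m _).
rewrite -scalemxAr [k%:C *: _]scalerA mulrC -scalerA -scalerBr; congr (_ *: _).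
rewrite mulmx_sumr scaler_sumr -sumrB; apply: eq_bigr => s _.
by rewrite scalerBr scalemxAr scalerA mulrC -scalerA.
Qed.

(** If an eigenfunction vanished at all interior points, the boundary conditions, whose coefficients
    are nonzero, would make it vanish at the end points as well. *)
Lemma sqnorm_neq0 l : (0 < l < N)%N -> sqnorm l != 0.
Proof.
move=> lN; have [[i leiN vi0] _ v0 vN] := SL.1 l lN.
apply: contraNneq vi0 => /eqP; rewrite psumr_eq0 => [/allP v0s|j _]; last
  exact: sqr_ge0.
have {}v0s j : (0 < j < N)%N -> v l j = 0.
  move=> jN; have := v0s j; rewrite mem_index_iota => /(_ jN) /=.
  by rewrite sqrf_eq0 => /eqP.
have [->|i0] := posnP i.
  have v1 : v l 1%N = 0 by apply: v0s.
  move: v0; rewrite v1 sub0r mulrN -{1}[v l 0%N]mul1r -mulrBl => /eqP.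
  by rewrite mulf_eq0 (negPf alphaN).
move: leiN; rewrite leq_eqVlt => /orP[/eqP ->|ltiN]; last by rewrite v0s ?i0.
have vN1 : v l N.-1 = 0 by apply: v0s; lia.
move: vN; rewrite vN1 subr0 -{1}[v l N]mul1r -mulrDl => /eqP.
by rewrite mulf_eq0 (negPf betaN).
Qed.

(** Orthogonality makes [W] a right inverse of the matrix [V] of the eigenfunctions; both are square
    of size [N - 1], so [W] is a left inverse too, which is completeness. *)
Lemma SL_complete i j : (0 < i < N)%N -> (0 < j < N)%N ->
  \sum_(1 <= l < N) (v l i * v l j) / sqnorm l = (i == j)%:R.
Proof.
move=> iN jN; pose n := N.-1.
have bigN (V : nmodType) (f : nat -> V) : \sum_(1 <= i < N) f i = \sum_(i < n)
  f i.+1.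
  by rewrite big_add1 big_mkord.
have ordN (a : 'I_n) : (0 < a.+1 < N)%N by have := ltn_ord a; rewrite /n; lia.
pose V := \matrix_(a < n, b < n) v a.+1 b.+1.
pose W := \matrix_(a < n, b < n) (v b.+1 a.+1 / sqnorm b.+1).
have VW : V *m W = 1%:M.
  apply/matrixP => a b; rewrite !mxE.
  under eq_bigr do rewrite !mxE mulrA.
  rewrite -mulr_suml -(bigN _ (fun c => v a.+1 c * v b.+1 c)).
  have [->|neq_ab] := eqVneq a b.
    rewrite mulr1n /sqnorm; under eq_bigr do rewrite -expr2.
    by rewrite mulfV // sqnorm_neq0.
  rewrite SL.2 ?mul0r // => -[/val_inj/eqP]; exact/negP.
have lti : (i.-1 < n)%N by rewrite /n; lia.
have ltj : (j.-1 < n)%N by rewrite /n; lia.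
have /matrixP/(_ (Ordinal ltj) (Ordinal lti)) := mulmx1C VW.
rewrite !mxE /= -val_eqE /= bigN.
have -> : (j.-1 == i.-1) = (i == j) by apply/idP/idP; lia.
move=> <-; apply: eq_bigr => l _; rewrite !mxE /=.
have [-> ->] : j.-1.+1 = j /\ i.-1.+1 = i by lia.
by rewrite [in RHS]mulrAC [v _ j * _]mulrC.
Qed.

(** Completeness gives the interior points. At an end point, [W] and all [v l] satisfy the same
    boundary condition, which determines the value there from that of the neighbour. *)
Lemma SL_expansion i (W : nat -> 'cV[R[i]]_m.+1) : (i <= N)%N ->
    SL_boundary_at N alpha beta W i ->
  \sum_(1 <= l < N) (v l i)%:C *: SL_coef l W = W i.
Proof.
have interior j : (0 < j < N)%N -> \sum_(1 <= l < N) (v l j)%:C *: SL_coef l W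
  = W j.
  move=> jN; rewrite /SL_coef.
  under eq_bigr do rewrite scalerA scaler_sumr.
  rewrite exchange_big /=.
  under eq_bigr => s _ do under eq_bigr => l _ do rewrite scalerA.
  transitivity (\sum_(1 <= s < N) ((j == s)%:R : R)%:C *: W s).
    rewrite big_nat [RHS]big_nat; apply: eq_bigr => s sN.
    rewrite -scaler_suml -(SL_complete jN sN) rmorph_sum; congr (_ *: _).
    by apply: eq_bigr => l _; rewrite !rmorphM fmorphV mulrAC.
  rewrite (big_rem j) ?mem_index_iota //= eqxx rmorph1 scale1r big1_seq ?addr0
    //.
  move=> s; rewrite mem_rem_uniq ?iota_uniq // inE eq_sym => /andP[_
    /andP[/negPf -> _]].
  by rewrite rmorph0 scale0r.
move=> leiN [W0 WN].
have SLb l (lN : (0 < l < N)%N) := SL.1 l lN.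
have cancelC (c : R) (X Y : 'cV[R[i]]_m.+1) : c != 0 -> c%:C *: X = c%:C *: Y
  -> X = Y.
  by move=> c0; apply: scalerI; rewrite fmorph_eq0.
have [i0|i_gt0] := posnP i.
  move/W0: (i0); rewrite i0 => {}W0; apply: (cancelC _ _ _ alphaN).
  transitivity ((- (alpha * N%:R))%:C *: W 1%N).
    rewrite -(interior 1%N) // !scaler_sumr big_nat [RHS]big_nat.
    apply: eq_bigr => l /SLb[_ _ v0 _]; move: (SL_coef l W) => c.
    rewrite !scalerA -!rmorphM; congr (_%:C *: _).
    apply/eqP; rewrite -subr_eq0 -v0; apply/eqP; ring.
  apply: subr0_eq.
  transitivity (- (W 0%N + (alpha * N%:R)%:C *: (W 1%N - W 0%N))); last first.
    by rewrite W0 oppr0.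
  rewrite rmorphB rmorphN rmorph1; apply/colP => t; rewrite !mxE; ring.
move: leiN; rewrite leq_eqVlt => /orP[/eqP iN|ltiN]; last by rewrite interior
  ?i_gt0.
move/WN: (iN); rewrite iN => {}WN; apply: (cancelC _ _ _ betaN).
transitivity ((beta * N%:R)%:C *: W N.-1).
  rewrite -(interior N.-1); last by lia.
  rewrite !scaler_sumr big_nat [RHS]big_nat.
  apply: eq_bigr => l /SLb[_ _ _ vN]; move: (SL_coef l W) => c.
  rewrite !scalerA -!rmorphM; congr (_%:C *: _).
  apply/eqP; rewrite -subr_eq0 -vN; apply/eqP; ring.
apply: subr0_eq.
transitivity (- (W N + (beta * N%:R)%:C *: (W N - W N.-1))); last first.
  by rewrite WN oppr0.
rewrite rmorphD rmorph1; apply/colP => t; rewrite !mxE; ring.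
Qed.
End SturmLiouville.

(** * Assembling the modes *)

Section DrazinData.
Variables (C : numClosedFieldType) (m : nat) (A E ED : 'M[C]_m.+1) (gamma : C).
Let K := invmx (gamma *: E + A).
Let Ehat := K *m E.
Let Ahat := K *m A.
Let D := ED *m Ahat.
Let Pi := Ehat *m ED.
Hypotheses (pencil : gamma *: E + A \in unitmx) (drazin : is_drazin Ehat ED).

(** All commutation relations of [Ahat] below rest on this affine expression. *)
Let AhatE : Ahat = 1%:M - gamma *: Ehat.
Proof.
rewrite /Ahat /Ehat scalemxAr; apply/eqP.
by rewrite eq_sym subr_eq addrC -mulmxDr mulVmx.
Qed.

Let commED : ED *m Ehat = Ehat *m ED. Proof. by have [q _ []] := drazin. Qed.
Let EDEED : ED *m Ehat *m ED = ED. Proof. by have [q _ []] := drazin. Qed.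

Let commEDA : ED *m Ahat = Ahat *m ED.
Proof.
by rewrite AhatE mulmxBr mulmxBl mulmx1 mul1mx -scalemxAl -scalemxAr commED.
Qed.

Let commEA : Ehat *m Ahat = Ahat *m Ehat.
Proof. by rewrite AhatE mulmxBr mulmxBl mulmx1 mul1mx -scalemxAl -scalemxAr.
  Qed.

Lemma drazin_proj_idem : Pi *m Pi = Pi.
Proof. by rewrite /Pi -mulmxA [ED *m (_ *m _)]mulmxA EDEED. Qed.

Lemma drazin_quotient_proj : D *m Pi = D.
Proof. by rewrite /D /Pi commEDA -mulmxA [ED *m (_ *m _)]mulmxA EDEED. Qed.

Lemma proj_drazin_quotient : Pi *m D = D.
Proof. by rewrite /D /Pi -commED mulmxA EDEED. Qed.

(** An invertible [D] could be cancelled from [D Pi = D]; then [Pi = 1], and [E] would be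
    invertible. *)
Lemma drazin_quotient_singular : E \notin unitmx -> D \notin unitmx.
Proof.
apply: contra => Du.
have Pi1 : Pi = 1%:M by rewrite -[Pi]mul1mx -(mulVmx Du) -mulmxA
  drazin_quotient_proj.
have Eu : Ehat \in unitmx by case: (mulmx1_unit Pi1).
by move: Eu; rewrite unitmx_mul => /andP[].
Qed.

(** This converts the recurrence in [D] into one in [A] and [E]. It follows from
    [Ehat D = Pi Ahat = Ahat Pi] on multiplying by the pencil. *)
Lemma drazin_quotientE (n : nat) (x : 'M[C]_(m.+1, n)) : Pi *m x = x -> E *m (D
  *m x) = A *m x.
Proof.
move=> Pix.
have EE : E = (gamma *: E + A) *m Ehat by rewrite mulmxA mulmxV // mul1mx.
have AE : A = (gamma *: E + A) *m Ahat by rewrite mulmxA mulmxV // mul1mx.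
have PiA : Pi *m Ahat = Ahat *m Pi.
  by rewrite /Pi -mulmxA commEDA mulmxA commEA -mulmxA.
have EDx : Ehat *m (D *m x) = Ahat *m x.
  transitivity (Pi *m Ahat *m x); first by rewrite /D /Pi !mulmxA.
  by rewrite PiA -[LHS]mulmxA Pix.
rewrite [in LHS]EE -[LHS]mulmxA EDx [in RHS]AE -[RHS]mulmxA; congr (_ *m _).
Qed.

End DrazinData.

(** * From single modes and small steps to stability *)

Section FiniteBounds.
Variables (R : realType) (m : nat).

Lemma mxnorm_sum_bounded (P : R -> nat -> nat -> Prop)
    (X : nat -> R -> nat -> nat -> 'cV[R[i]]_m.+1) n :
    (forall l, (0 < l < n)%N -> exists (K : R[i]) (k0 : R), 0 < k0 /\
       forall k i j, k <= k0 -> P k i j -> mxnorm (X l k i j) <= K) ->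
  exists (K : R[i]) (k0 : R), 0 < k0 /\
    forall k i j, k <= k0 -> P k i j -> mxnorm (\sum_(1 <= l < n) X l k i j) <=
      K.
Proof.
elim: n => [|[|n] IHn] bX.
- exists (mxnorm (0 : 'cV[R[i]]_m.+1)), 1; split=> // k i j _ _.
  by rewrite big_geq.
- exists (mxnorm (0 : 'cV[R[i]]_m.+1)), 1; split=> // k i j _ _.
  by rewrite big_geq.
have [l ln|K [k0 [k0_gt0 KP]]] := IHn; first by apply: bX; lia.
have [|K' [k1 [k1_gt0 KP']]] := bX n.+1; first by lia.
exists (K + K'), (Num.min k0 k1); split; first by rewrite lt_min k0_gt0.
move=> k i j; rewrite le_min => /andP[le0 le1] Pkij.
rewrite big_nat_recr //=; apply: le_trans (mxnormD _ _) _.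
by apply: lerD; [apply: KP|apply: KP'].
Qed.

(* Time steps bounded away from 0 are harmless: [k * M = T] leaves finitely
   many of them. *)
Lemma stable_of_small_steps N (T : R) (adm : R -> Prop)
    (U : R -> nat -> nat -> 'cV[R[i]]_m.+1) :
    0 < T -> (forall k, adm k -> 0 < k) ->
    (exists (K : R[i]) (k0 : R), 0 < k0 /\ forall k i j, k <= k0 ->
       [/\ adm k, (i <= N)%N & k * j%:R <= T] -> mxnorm (U k i j) <= K) ->
  stable N T adm U.
Proof.
move=> T0 adm0 [K [k0 [k0_gt0 KP]]].
(* A step [k > k0] is one of the values [T / M] with [M < M0], and [B] sums the norms over all of
   them; [M = 0] merely adds a nonnegative term. *)
pose M0 := (Num.bound (T / k0)).+1.
pose B := \sum_(M < M0) \sum_(j < M0) \sum_(i < N) mxnorm (U (T / M%:R) i j).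
have B0 : 0 <= B.
  do 3 (apply: sumr_ge0 => ? _); exact: mxnorm_ge0.
have KB0 : 0 <= `|K| + B by rewrite addr_ge0.
exists (complex.Re (`|K| + B)) => k M admk kM i j a iN jM.
rewrite -ge0_complexE //; apply: le_trans (mxnorm_entry _ _ _) _.
have k_gt0 := adm0 _ admk.
have [le_k|lt_k] := leP k k0.
  have leK : mxnorm (U k i j) <= K.
    apply: KP => //; split=> //; first by lia.
    by rewrite -kM ler_pM2l // ler_nat; lia.
  rewrite (le_trans leK) // -[leLHS]addr0 lerD //.
  by rewrite ger0_norm // (le_trans (mxnorm_ge0 _) leK).
have M_gt0 : (0 < M)%N by lia.
have kE : k = T / M%:R by rewrite -kM mulfK // pnatr_eq0 -lt0n.
have ltM : (M < M0)%N.
  rewrite ltnS ltnW // -(ltr_nat R); apply: le_lt_trans (archi_boundP _); last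
    first.
    by rewrite divr_ge0 // ltW.
  by rewrite ler_pdivlMr // -kM mulrC ler_wpM2r // ltW.
have ltj : (j < M0)%N by lia.
have ltiN : (i < N)%N by lia.
apply: le_trans (_ : B <= _); last by rewrite lerDr.
rewrite kE /B (bigD1 (Ordinal ltM)) //= (bigD1 (Ordinal ltj)) //= (bigD1
  (Ordinal ltiN)) //=.
have n0 (M' j' i' : nat) : 0 <= mxnorm (U (T / M'%:R) i' j') := mxnorm_ge0 _.
have s1 (r : seq 'I_N) p M' j' : 0 <= \sum_(i' <- r | p i') mxnorm (U (T /
  M'%:R) i' j').
  by apply: sumr_ge0 => i' _; apply: n0.
rewrite -!addrA lerDl addr_ge0 ?s1 // addr_ge0 //.
  by apply: sumr_ge0 => j' _; apply: s1.
by apply: sumr_ge0 => M' _; apply: sumr_ge0 => j' _; apply: s1.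
Qed.

End FiniteBounds.

(** * Superposition of separated solutions *)

Section ModalSums.
Variables (R : realType) (m N : nat) (alpha beta k : R).
Variables (lam : nat -> R) (v : nat -> nat -> R) (W : nat -> nat ->
  'cV[R[i]]_m.+1).
Hypothesis SL : SL_eigensystem N alpha beta lam v.
Implicit Types M : 'M[R[i]]_m.+1.

Definition modal_sum i j : 'cV[R[i]]_m.+1 := \sum_(1 <= l < N) (v l i)%:C *: W
  l j.

(** Mode by mode, the second difference in space produces [- lam l] and the one in time
    [rho = - r^2 lam l]; the two contributions cancel. *)
Lemma modal_sum_equation A E D :
    (forall l j, (0 < l < N)%N -> W l j.+2 + W l j =
       2%:R *: W l j.+1 + (rho N lam k l)%:C *: (D *m W l j.+1)) ->
    (forall l j, (0 < l < N)%N -> E *m (D *m W l j) = A *m W l j) ->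
  difference_equation N A E k modal_sum.
Proof.
move=> rec EDW r2 i j iN; case: j => // j _.
have sum_i : modal_sum i.+1 j.+1 + modal_sum i.-1 j.+1 =
    \sum_(1 <= l < N) ((2%:R - lam l) * v l i)%:C *: W l j.+1.
  rewrite /modal_sum -big_split big_nat [RHS]big_nat; apply: eq_bigr => l lN.
  have [_ vrec _ _] := SL.1 l lN; rewrite /= -scalerDl -rmorphD; congr (_%:C *:
    _).
  by apply: subr0_eq; rewrite -(vrec i iN); ring.
have sum_j : E *m (modal_sum i j.+2 + modal_sum i j) = \sum_(1 <= l < N)
    (v l i)%:C *: (2%:R *: (E *m W l j.+1) + (rho N lam k l)%:C *: (A *m W l
      j.+1)).
  rewrite /modal_sum -big_split mulmx_sumr big_nat [RHS]big_nat.
  apply: eq_bigr => l lN; rewrite /= -scalerDr rec // -scalemxAr mulmxDr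
    -!scalemxAr.
  by rewrite EDW.
rewrite sum_i [j.+1.-1]/= sum_j mulmx_sumr scaler_sumr.
rewrite [modal_sum i j.+1]/modal_sum mulmx_sumr scaler_sumr -big_split -sumrB.
rewrite big_nat big1 // => l _; rewrite /= -!scalemxAr mulmxBl -scalemxAl.
have -> : (rho N lam k l)%:C = - r2 * (lam l)%:C.
  by rewrite /rho rmorphM rmorphN.
have -> : ((2%:R - lam l) * v l i)%:C = (2%:R - (lam l)%:C) * (v l i)%:C.
  by rewrite rmorphM rmorphB rmorph_nat.
move: (A *m _) (E *m _) => a e.
by apply/colP => t; rewrite !mxE; ring.
Qed.

(** On the modes [M'] acts as [c M], so the expression is [M W] times the scalar boundary condition.
    The points [a], [p], [q] cover both ends: [0, 1, 0] and [N, N, N-1]. *)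
Lemma modal_sum_boundary (c : R) a p q M M' j :
    (forall l, (0 < l < N)%N -> v l a + c * N%:R * (v l p - v l q) = 0) ->
    (forall l, (0 < l < N)%N -> (c%:C *: M - M') *m W l j = 0) ->
  M *m modal_sum a j + N%:R *: (M' *m (modal_sum p j - modal_sum q j)) = 0.
Proof.
move=> bv MW; have sumB : modal_sum p j - modal_sum q j =
    \sum_(1 <= l < N) (v l p - v l q)%:C *: W l j.
  by rewrite /modal_sum -sumrB; apply: eq_bigr => l _; rewrite rmorphB scalerBl.
rewrite sumB /modal_sum !mulmx_sumr scaler_sumr -big_split big_nat big1 // => l
  lN.
move: (MW l lN); rewrite mulmxBl -scalemxAl => /subr0_eq M'W.
rewrite /= -!scalemxAr -M'W; move: (M *m _) => w.
transitivity ((v l a + c * N%:R * (v l p - v l q))%:C *: w); last first.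
  by rewrite bv // scale0r.
have -> : (v l a + c * N%:R * (v l p - v l q))%:C =
    (v l a)%:C + c%:C * N%:R * (v l p - v l q)%:C.
  by rewrite rmorphD /= !rmorphM /= rmorph_nat.
by apply/colP => t; rewrite !mxE; ring.
Qed.

End ModalSums.

(** * Solution and stability of the discrete problem *)

Theorem mainTheorem1 (R : realType) (m N : nat) (T : R)
  (f g : R -> 'cV[R[i]]_m.+1)
  (A A1 A2 B1 B2 E : 'M[R[i]]_m.+1) (gamma : R[i])
  (ED : 'M[R[i]]_m.+1)
  (alpha beta : R) (lam : nat -> R) (v : nat -> nat -> R)
  (calGp : 'M[R[i]]_(m.+1, m.+1 + m.+1))
  (F G : nat -> 'cV[R[i]]_m.+1)
  (Z0 Z1 MG : R -> nat -> 'M[R[i]]_m.+1) :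
  let K := invmx (gamma *: E + A) in
  let Ehat := K *m E in
  let Ahat := K *m A in
  let D := ED *m Ahat in
  let Pi := Ehat *m ED in
  let calG := col_mx (alpha%:C *: A1 - A2) (beta%:C *: B1 - B2) in
  let U := fun k : R => series_solution N Pi (Z0 k) (Z1 k) (MG k) F G v k in
  (2 <= N)%N ->
  0 < T ->
  E \notin unitmx ->
  gamma *: E + A \in unitmx ->
  is_drazin Ehat ED ->
  (exists2 z, eigenvalue D z & z != 0) ->
  1 - alpha * N%:R != 0 ->
  1 + beta * N%:R != 0 ->
  SL_eigensystem N alpha beta lam v ->
  (\rank calG < m.+1)%N ->
  (forall i, (i <= N)%N ->
     F i = f (i%:R * space_step R N) /\ G i = g (i%:R * space_step R N)) ->
  bounded_mesh N F -> bounded_mesh N G ->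
  (forall i, (i <= N)%N -> Pi *m F i = F i /\ Pi *m G i = G i) ->
  (forall i, (0 < i < N)%N -> calG *m F i = 0 /\ calG *m G i = 0) ->
  is_moore_penrose calG calGp ->
  calG *m D *m (1%:M - calGp *m calG) = 0 ->
  (forall k, admissible_step N D lam k -> forall l, (0 < l < N)%N ->
     is_Z_pair (rho N lam k l)%:C D Pi (Z0 k l) (Z1 k l) /\
     is_core_ginv ((Z1 k l - Z0 k l) *m Pi) (MG k l)) ->
  (forall k, admissible_step N D lam k ->
     [/\ difference_equation N A E k (U k),
         left_boundary N A1 A2 (U k),
         right_boundary N B1 B2 (U k) &
         forall i, (i <= N)%N ->
           (in_range D (F i) -> SL_boundary_at N alpha beta F i ->
              U k i 0%N = F i) /\
           (in_range D (G i) -> SL_boundary_at N alpha beta G i ->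
              (k%:C)^-1 *: (U k i 1%N - U k i 0%N) = G i)]) /\
  stable N T (admissible_step N D lam) U.
Proof.
move=> K Ehat Ahat D Pi calG U N2 T_gt0 Esing pencil drazin [z eig_z z0] alphaN
  betaN SL _ _ _ _.
move=> PiFG kerFG _ calGD pairs; pose adm := admissible_step N D lam.
have DPi : D * Pi = D := drazin_quotient_proj pencil drazin.
have PiD : Pi * D = D := proj_drazin_quotient drazin.
have PiPi : Pi * Pi = Pi := drazin_proj_idem drazin.
have Dsing : D \notin unitmx := drazin_quotient_singular pencil drazin Esing.
have EDA (t : 'cV_m.+1) : Pi *m t = t -> E *m (D *m t) = A *m t.
  exact: drazin_quotientE.
clearbody D Pi.
pose x l := SL_coef N v l F; pose y l := SL_coef N v l G.
(* Only interior mesh values enter a coefficient, so linear conditions satisfied there pass to [x l]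
   and [y l]. *)
have coef_ind (P : 'cV[R[i]]_m.+1 -> Prop) (W : nat -> 'cV[R[i]]_m.+1) l :
    P 0 -> (forall a b, P a -> P b -> P (a + b)) -> (forall c a, P a -> P (c *:
      a)) ->
    (forall i, (0 < i < N)%N -> P (W i)) -> P (SL_coef N v l W).
  move=> P0 PD PZ PW; apply: (PZ); rewrite big_nat.
  by apply: big_ind => // i iN; apply: (PZ); apply: PW.
have [Pix Piy] : (forall l, Pi *m x l = x l) /\ (forall l, Pi *m y l = y l).
  by split=> l; apply: (coef_ind (fun a => Pi *m a = a)) => [|a b ea eb|c a
    ea|i iN];
    rewrite ?mulmx0 ?mulmxDr ?ea ?eb // -?scalemxAr ?ea //;
    have [] := PiFG i _; rewrite // ltnW //; case/andP: iN.
have [Gx Gy] : (forall l, calG *m x l = 0) /\ (forall l, calG *m y l = 0).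
  by split=> l; apply: (coef_ind (fun a => calG *m a = 0)) => [|a b ea eb|c a
    ea|i iN];
    rewrite ?mulmx0 ?mulmxDr ?ea ?eb ?addr0 // -?scalemxAr ?ea ?scaler0 //;
    have [] := kerFG i iN.
pose W k l := mode_vec Pi (Z0 k l) (Z1 k l) (MG k l) k%:C (x l) (y l).
have UE k : U k = modal_sum N v (W k).
  apply/funext => i; apply/funext => j.
  by apply: eq_bigr => l _; rewrite coefP_SL_coef coefQ_SL_coef.
have modes k l : adm k -> (0 < l < N)%N ->
    let rho := (rho N lam k l)%:C in
    let F := 1%:M + (rho / 4%:R) *: D in let L := 1%:M + (rho / 2%:R) *: D in
    [/\ rho != 0, F \in unitmx, group_inverse ((Z1 k l - Z0 k l) *m Pi) (MG k
      l) &
    exists w u, let S := D * horner_mx D w in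
    [/\ D = D * D * horner_mx D u, S * S = rho *: (D * F),
        Z0 k l = (L + S) * Pi & Z1 k l = (L - S) * Pi]].
  move=> admk lN rh; have [/= spec _] := admk.2 l lN.
  have rh0 : rh != 0.
    by apply: contraNneq (spec z eig_z z0) => rh0; rewrite -/rh rh0 !mul0r.
  have [pairZ ginv] := pairs k admk l lN.
  have [Fu wu] := Z_pair_structure rh0 Dsing spec pairZ.
  by split=> //; apply: core_ginv_group_inverse.
split.
  move=> k admk.
  (* The relation [D = D^2 u(D)] does not involve the mode; the [u] of mode 1, which exists as
     [N >= 2], serves for all. *)
  have l1 : (0 < 1 < N)%N by [].
  have [_ _ _ [_ [u [Didx _ _ _]]]] := modes k 1%N admk l1.
  have rec l j : (0 < l < N)%N -> W k l j.+2 + W k l j =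
      2%:R *: W k l j.+1 + (rho N lam k l)%:C *: (D *m W k l j.+1).
    move=> lN; have [_ _ ginv [w [u' [_ S2 Z0E Z1E]]]] := modes k l admk lN.
    exact: (mode_vec_recurrence DPi PiD PiPi S2 Z0E Z1E ginv _ (Pix l) (Piy l)).
  have PiW l j : (0 < l < N)%N -> Pi *m W k l j = W k l j.
    move=> lN; have [_ _ ginv [w [u' [_ S2 Z0E Z1E]]]] := modes k l admk lN.
    exact: (proj_mode_vec DPi PiD PiPi Z0E Z1E ginv _ (Pix l) (Piy l)).
  have GW l j : (0 < l < N)%N -> calG *m W k l j = 0.
    move=> lN; have [_ _ ginv [w [u' [_ S2 Z0E Z1E]]]] := modes k l admk lN.
    exact: (mode_vec_ker DPi PiD PiPi Z0E Z1E ginv _ (Pix l) (Piy l) _ calGD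
      (Gx l) (Gy l)).
  have W0 l : (0 < l < N)%N -> W k l 0%N = D *m horner_mx D u *m x l.
    move=> lN; have [rho0 Fu ginv [w [u' [_ S2 Z0E Z1E]]]] := modes k l admk lN.
    exact: (mode_vec0 DPi PiD PiPi rho0 Fu S2 Didx Z0E Z1E ginv _ (Pix l) (Piy
      l)).
  have W1 l : (0 < l < N)%N -> W k l 1%N - W k l 0%N = k%:C *: (D *m horner_mx
    D u *m y l).
    move=> lN; have [rho0 Fu ginv [w [u' [_ S2 Z0E Z1E]]]] := modes k l admk lN.
    exact: (mode_vec1 DPi PiD PiPi rho0 Fu S2 Didx Z0E Z1E ginv _ (Pix l) (Piy
      l)).
  have range_fix t : in_range D t -> D *m horner_mx D u *m t = t.
    move=> [t' ->]; rewrite mulmxA; congr (_ *m _).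
    rewrite [in RHS]Didx !mulmxE -!mulrA; congr (_ * _).
    exact/esym/comm_mx_horner.
  have kC0 : k%:C != 0 by rewrite gt_eqF // ltcR admk.1.
  rewrite UE; split.
  - apply: (modal_sum_equation SL) => [l j lN|l j lN]; first exact: rec.
    by apply: EDA; apply: PiW.
  - move=> j _; apply: (modal_sum_boundary (c := alpha)) => l lN.
      by have [] := SL.1 l lN.
    by have /eqP := GW l j lN; rewrite mul_col_mx col_mx_eq0 => /andP[/eqP].
  - move=> j _; apply: (modal_sum_boundary (c := beta)) => l lN.
      by have [] := SL.1 l lN.
    by have /eqP := GW l j lN; rewrite mul_col_mx col_mx_eq0 => /andP[_ /eqP].
  - move=> i iN; split=> [DF bF|DG bG].
      rewrite /modal_sum -[RHS](range_fix _ DF) -(SL_expansion N2 alphaN betaN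
        SL iN bF).
      rewrite mulmx_sumr big_nat [RHS]big_nat; apply: eq_bigr => l lN.
      by rewrite W0 //; exact: scalemxAr.
    rewrite /modal_sum -sumrB -[RHS](range_fix _ DG) -(SL_expansion N2 alphaN
      betaN SL iN bG).
    rewrite mulmx_sumr scaler_sumr big_nat [RHS]big_nat; apply: eq_bigr => l lN.
    rewrite -scalerBr W1 // -/(y l); move: (D *m _) (y l) => e t.
    by rewrite !scalerA mulrAC mulVf // mul1r scalemxAr.
apply: stable_of_small_steps => // [k [] //|].
(* One admissible step supplies a [u] valid for all steps, as a uniform bound requires; without any,
   there is nothing to bound. *)
have [[k1 admk1]|no_adm] := pselect (exists k, adm k); last first.
  exists 0, 1; split=> // k i j _ [admk _ _]; case: no_adm; by exists k.
have l1 : (0 < 1 < N)%N by [].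
have [_ _ _ [_ [u [Didx _ _ _]]]] := modes k1 1%N admk1 l1.
have [|Kb [k0 [k0_gt0 KP]]] := @mxnorm_sum_bounded R m
  (fun k i j => [/\ adm k, (i <= N)%N & k * j%:R <= T])
  (fun l k i j => (v l i)%:C *: W k l j) N; last first.
  exists Kb, k0; split; first exact: k0_gt0.
  by move=> k i j le_k adm_kij; rewrite UE; exact: KP le_k adm_kij.
(* Since [r = k N], this gives [rho = (k theta)^2] with [theta] independent of [k]; it is imaginary
   when [lam l > 0]. *)
move=> l lN; pose theta : R[i] := sqrtC (- (lam l * N%:R ^+ 2))%:C.
have rhoE k : (rho N lam k l)%:C = (k%:C * theta) ^+ 2.
  rewrite exprMn sqrtCK /rho /mesh_ratio /space_step invrK -rmorphXn -rmorphM.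
  by congr (_%:C); ring.
have theta0 : theta != 0.
  have [rho0 _ _ _] := modes k1 l admk1 lN.
  by apply: contraNneq rho0 => t0; rewrite rhoE t0 mulr0 expr0n.
have [Kl [k0 [k0_gt0 KP]]] := mode_vec_bounded T (y l) Didx theta0 DPi PiD PiPi
  (Pix l).
exists ((\sum_(i < N.+1) `|v l i|)%:C * Kl), k0; split; first exact: k0_gt0.
move=> k i j le_k [admk iN kjT].
have [_ Fu ginv [w [u' [_ S2 Z0E Z1E]]]] := modes k l admk lN.
rewrite mxnormZ; apply: ler_pM; rewrite ?mxnorm_ge0 //.
  rewrite normc_def /= expr0n addr0 sqrtr_sqr lecR.
  have ltiN : (i < N.+1)%N by [].
  by rewrite (bigD1 (Ordinal ltiN)) //= lerDl sumr_ge0.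
have k_gt0 : 0 < k := admk.1.
have k_bnd : 0 < k <= k0 by rewrite k_gt0.
rewrite rhoE in Fu S2 Z0E Z1E.
exact: (KP k w _ _ _ j k_bnd kjT Fu S2 Z0E Z1E ginv).
Qed.
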